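(* For an odd prime $p$ and $b\in\mathbb{F}_p$, let $U_{p,b}$ be the curve over $\mathbb{F}_p$ with affine equation $x^6+y^6+1+bx^2y^2=0$. Then $U_{p,b}$ is $\mathbb{F}_{p^2}$-maximal when $$(p,b)\in\{(89,58),(101,96),(131,100),(191,116),(227,69),(239,94),(251,3)\},$$ where the integer $b$ is read modulo $p$.
   Context: A curve given by an affine plane equation means the projective, non-singular, geometrically irreducible algebraic curve with the corresponding function field. A curve $\mathcal{X}$ of genus $g$ defined over $\mathbb{F}_{p^2}$ is $\mathbb{F}_{p^2}$-maximal if $|\mathcal{X}(\mathbb{F}_{p^2})|=p^2+1+2gp$. *)

(* Defs.v *)
From mathcomp Require Import all_boot all_order all_algebra.
From mathcomp Require Import all_classical.

Set Implicit Arguments.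
Unset Strict Implicit.
Unset Printing Implicit Defensive.

Import GRing.Theory.
Local Open Scope classical_set_scope.
Local Open Scope card_scope.
Local Open Scope ring_scope.

Definition U_eqn (R : nzRingType) (b : R) : {poly {poly R}} :=
  'X ^+ 6 + 'Y ^+ 6 + 1 + b%:P%:P * 'X ^+ 2 * 'Y ^+ 2.

Definition base_change (R S : nzRingType) (j : {rmorphism R -> S})
    (f : {poly {poly R}}) : {poly {poly S}} :=
  map_poly (map_poly j) f.

Definition irreducible_element (A : idomainType) (a : A) : Prop :=
  [/\ a != 0, a \isn't a GRing.unit
    & forall g h : A, a = g * h -> g \is a GRing.unit \/ h \is a GRing.unit].

Definition geometrically_irreducible (k : fieldType) (f : {poly {poly k}}) :
    Prop :=
  forall (L : fieldType) (j : {rmorphism k -> L}),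
    irreducible_element (base_change j f).

(* The projective non-singular geometrically irreducible curve over k with
   affine equation f = 0, given by its function field Frac(k[x, y]/(f)), which
   determines it up to isomorphism. *)
Record plane_curve (k : fieldType) (f : {poly {poly k}}) := PlaneCurve {
  function_field : fieldType;
  constant : {rmorphism k -> function_field};
  coord_x : function_field;
  coord_y : function_field;
  equation_irreducible : geometrically_irreducible f;
  equation_ideal : forall g : {poly {poly k}},
    (base_change constant g).[coord_x, coord_y] = 0 <-> exists h, g = h * f;
  coord_generate : forall z : function_field, exists g h : {poly {poly k}},
    (base_change constant h).[coord_x, coord_y] != 0 /\
    z = (base_change constant g).[coord_x, coord_y]
        / (base_change constant h).[coord_x, coord_y]
}.

Section FunctionField.
Variables (k : finFieldType) (K : fieldType) (iota : {rmorphism k -> K}).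

(* The points of the non-singular projective curve with function field K are
   the places of K over k, represented by their valuation rings. *)
Record valuation_ring (O : set K) : Prop := ValuationRing {
  valuation_ring_const : forall c : k, O (iota c);
  valuation_ring_sub : forall u v, O u -> O v -> O (u - v);
  valuation_ring_mul : forall u v, O u -> O v -> O (u * v);
  valuation_ring_proper : O <> setT;
  valuation_ring_total : forall z, O z \/ O z^-1
}.

Definition maximal_ideal (O : set K) : set K :=
  [set z | O z /\ (z = 0 \/ ~ O z^-1)].

(* A point is k-rational when its residue field is k. *)
Definition rational_points : set (set K) :=
  [set O | valuation_ring O /\
           forall z, O z -> exists c : k, maximal_ideal O (z - iota c)].

Record derivation := Derivation {
  der :> K -> K;
  derD : forall u v, der (u + v) = der u + der v;
  derM : forall u v, der (u * v) = u * der v + v * der u;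
  der_const : forall c : k, der (iota c) = 0
}.

(* The K-space of Kaehler differentials of K over k embeds in its bidual, i.e.
   in the K-valued functions on the derivations, where a * db is the function
   D |-> a * D b. *)
Definition differential (s : seq (K * K)) : derivation -> K :=
  fun D => \sum_(ab <- s) ab.1 * D ab.2.

(* A differential is regular at O if it is a sum of a * db with a, b in O. *)
Definition regular_at (O : set K) (w : derivation -> K) : Prop :=
  exists2 s : seq (K * K),
    (forall ab, ab \in s -> O ab.1 /\ O ab.2) & w = differential s.

Definition regular_differentials : set (derivation -> K) :=
  [set w | forall O, valuation_ring O -> regular_at O w].

(* The genus is the k-dimension of the space of regular differentials: it is g
   when this space has a k-basis e_0, ..., e_(g-1). As k is perfect, this is
   also the genus over an algebraic closure of k. *)
Definition has_genus (g : nat) : Prop :=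
  exists e : 'I_g -> derivation -> K,
    (forall c : {ffun 'I_g -> k},
        regular_differentials (fun D => \sum_(i < g) iota (c i) * e i D)) /\
    (forall w, regular_differentials w ->
       exists! c : {ffun 'I_g -> k},
         w = fun D => \sum_(i < g) iota (c i) * e i D).

(* Maximality over a field k with p ^ 2 elements. *)
Definition maximal (p : nat) : Prop :=
  exists2 g : nat, has_genus g &
    rational_points #= `I_(p ^ 2 + 1 + 2 * g * p).

End FunctionField.

(* The function field of f is unique up to isomorphism over k, so quantifying
   over all its copies is harmless; that there is one is part of the claim. *)
Definition maximal_plane_curve (p : nat) (k : finFieldType)
    (f : {poly {poly k}}) : Prop :=
  inhabited (plane_curve f) /\
  forall X : plane_curve f, maximal (constant X) p.

(* Main.v *)
From HB Require Import structures.
From Stdlib Require Import NArith ZArith.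
Require Import Defs.
From mathcomp Require Import all_boot all_order all_algebra.
From mathcomp Require Import all_classical.
From mathcomp Require Import fraction qpoly qfpoly finfield cyclic.
From mathcomp Require Import ring zify ssrZ.

(** The homogeneous equation X^6 + Y^6 + Z^6 + c X^2 Y^2 Z^2 = 0 defines a
   smooth plane curve as soon as 6 and c^3 + 27 are invertible: a common zero
   of the partial derivatives would satisfy X^6 = Y^6 = Z^6 and
   c X^2 Y^2 Z^2 = -3 Z^6. A smooth plane sextic has genus 10, so maximality
   over the field with p^2 elements means p^2 + 1 + 20 p rational points. The
   proof establishes irreducibility, the genus and the description of the
   rational places for every such c, and then counts points for the seven pairs.

   Irreducibility. As a polynomial in X the equation is g(X^2), with g a monic
   cubic over L[Y] without root and with -g(0) = -(Y^6 + 1) not a square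
   (sextic_fraction_irreducible). The function field is then the quotient of
   L(Y)[X] by the equation (plane_curve_exists).

   Places. A closed point m of the affine curve lies over a prime P of k[Y].
   When f_X does not vanish at m, the equation has the form Q R + P S, with m
   generated by P and Q and with R not in m, so P is a uniformizer of the local
   ring at m (ideal_fibre); otherwise f_Y does not vanish there and the two
   coordinates are exchanged. Hence these local rings are valuation rings and
   every valuation ring containing x and y is one of them (place_local_ring),
   and the coordinate ring is integrally closed (regular_functions). The chart
   (x/y, 1/y) satisfies the same equation, and the two charts cover all places
   (place_center).

   Genus. In each chart a differential is regular at a place exactly when its
   quotient by dx / f_Y belongs to the valuation ring (regular_atP). This
   differential is - (1/y)^3 times its analogue in the other chart
   (jacobian_infinity), so the regular differentials are the h dx / f_Y where h
   has no pole in the affine plane and at most a triple pole along the line at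
   infinity, that is, where h is a polynomial of degree at most 3
   (pole_order_degree). There are ten monomials of degree at most 3
   (sextic_genus).

   Points. The rational places are the rational points of the plane model
   (rational_points_card). Eighteen of them lie on the coordinate lines
   X = 0, Y = 0 and Z = 0. The others lie over points of the cubic
   s^3 + t^3 + 1 + c s t = 0 by s = x^2 and t = y^2, so they are counted by the
   sum of (1 + chi s) (1 + chi t), with chi the quadratic character. Permuting the three homogeneous coordinates shows
   that s, t and st contribute equally (sum_torus_point). In terms of z = s + t
   and q = st the cubic reads q (3 z - c) = z^3 + 1, and the count becomes a
   sum over z alone of products of characters of polynomials in z (sum_trace).
   On the quadratic extension of F_p, chi is the Legendre symbol of the norm
   (quad_char_ext), and conjugate values of z give equal terms; the remaining
   sum of about p^2 / 2 terms is computed for each of the seven primes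
   (character_check_correct). *)

Set Implicit Arguments.
Unset Strict Implicit.
Unset Printing Implicit Defensive.

Import Order.TTheory GRing.Theory Num.Theory.
Local Open Scope ring_scope.

Local Notation "x %:F" := (@FracField.tofrac _ x).

(** * Irreducibility of the sextic *)

Lemma fraction_div (R : idomainType) (r : {fraction R}) :
  exists n d : R, d != 0 /\ r = n%:F / d%:F.
Proof.
elim/quotW: r => r; exists (frac r).1, (frac r).2.
have d0 := denom_ratioP r; split=> //.
have d0' : ((frac r).2)%:F != 0 by rewrite tofrac_eq0.
apply: (mulIf d0'); rewrite divfK //.
unlock FracField.tofrac; rewrite -[LHS]FracField.pi_mul.
apply/eqmodP; rewrite /= FracField.equivfE /FracField.mulf /=.
by rewrite !numden_Ratio ?mulf_neq0 ?oner_eq0 //=; apply/eqP; ring.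
Qed.

Lemma scale_fraction_term (F : fieldType) (c n d : F) i j : d != 0 ->
  c * n ^+ i * d ^+ j = d ^+ (j + i) * (c * (n / d) ^+ i).
Proof.
move=> d0; rewrite exprMn exprVn exprD.
by field; rewrite expf_neq0.
Qed.

Section IntegrallyClosed.
Variable L : fieldType.
Implicit Types n d : {poly L}.

Lemma fraction_poly_coprime (r : {fraction {poly L}}) :
  exists n d, [/\ d != 0, coprimep n d & r = n%:F / d%:F].
Proof.
have [n [d [d0 ->]]] := fraction_div r.
have g0 : gcdp n d != 0 by rewrite gcdp_eq0 negb_and d0 orbT.
have dn := divpK (dvdp_gcdl n d); have dd := divpK (dvdp_gcdr n d).
exists (n %/ gcdp n d), (d %/ gcdp n d); split.
- by apply: contraNneq d0 => h; rewrite -dd h mul0r.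
- by rewrite coprimep_div_gcd // d0 orbT.
have gF0 : (gcdp n d)%:F != 0 by rewrite tofrac_eq0.
have dF0 : (d %/ gcdp n d)%:F != 0.
  by rewrite tofrac_eq0; apply: contraNneq d0 => h; rewrite -dd h mul0r.
have nE : n%:F = (n %/ gcdp n d)%:F * (gcdp n d)%:F by rewrite -tofracM dn.
have dE : d%:F = (d %/ gcdp n d)%:F * (gcdp n d)%:F by rewrite -tofracM dd.
by rewrite nE dE -mulf_div (divff gF0) mulr1.
Qed.

(** L[Y] is integrally closed: if n / d is a root in lowest terms of a monic
   polynomial, then d divides a power of n. *)
Lemma fraction_poly_integral (p : {poly {poly L}}) (r : {fraction {poly L}}) :
  p \is monic -> root (map_poly (@FracField.tofrac _) p) r ->
  exists s : {poly L}, r = s%:F.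
Proof.
move=> pm /rootP pr; have [n [d [d0 cnd rE]]] := fraction_poly_coprime r.
have d0F : d%:F != 0 by rewrite tofrac_eq0.
suff : d %| n ^+ (size p).-1.
  move=> dn; have : coprimep (n ^+ (size p).-1) d by apply: coprimep_expl.
  rewrite coprimep_sym => /coprimepP/(_ d (dvdpp _) dn).
  rewrite -size_poly_eq1 => /size_poly1P [c c0 dE].
  exists (c^-1 *: n); rewrite rE dE.
  have cF0 : (c%:P)%:F != 0 by rewrite tofrac_eq0 polyC_eq0.
  apply: (mulIf cF0); rewrite divfK // -tofracM -mul_polyC mulrAC -polyCM.
  by rewrite mulVf // mul1r.
have : \sum_(i < size p) (p`_i * n ^+ i * d ^+ ((size p).-1 - i)) = 0.
  apply/eqP; rewrite -tofrac_eq0 rmorph_sum /=; apply/eqP.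
  transitivity (d%:F ^+ (size p).-1 * (map_poly (@FracField.tofrac _) p).[r]);
    last by rewrite pr mulr0.
  have -> : (map_poly (@FracField.tofrac _) p).[r] =
     \sum_(i < size p) (p`_i)%:F * r ^+ i.
    rewrite (@horner_coef_wide _ (size p)) ?size_poly //.
    by apply: eq_bigr => i _; rewrite coef_map.
  rewrite mulr_sumr; apply: eq_bigr => i _.
  rewrite !tofracM !tofracXn rE.
  have le_i : (i <= (size p).-1)%N by rewrite -ltnS (ltn_predK (ltn_ord i)).
  rewrite -[in X in _ = X * _](subnK le_i).
  exact: scale_fraction_term.
have sp : (0 < size p)%N by rewrite size_poly_gt0 monic_neq0.
move: (monicP pm); rewrite lead_coefE.
case: (size p) sp => [//|m] _ /= pm1; rewrite big_ord_recr /= pm1.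
rewrite mul1r subnn mulr1 => /eqP; rewrite addrC addr_eq0 => /eqP ->.
rewrite dvdpNr; elim/big_ind: _ => [|a b|i _]; rewrite ?dvdp0 //; first exact: dvdp_add.
have -> : (m - i = (m - i.+1).+1)%N by rewrite subnSK.
by rewrite exprS mulrCA dvdp_mulr.
Qed.
End IntegrallyClosed.

Section Sextic.
Variables (L : fieldType) (b : L).
Hypotheses (six0 : 6%:R != 0 :> L) (b0 : b ^+ 3 + 27%:R != 0).

Let three0 : 3%:R != 0 :> L.
Proof. by apply: contraNneq six0 => h; rewrite (natrM _ 2 3) h mulr0. Qed.

(** For degree reasons r = u Y^2 + v Y + w. The coefficients of Y^6, Y^5, Y^4
   and 1 give u^3 = w^3 = -1, v = 0 and b = - 3 u w, hence b^3 = - 27: this is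
   the case where the cubic degenerates into three lines. *)
Lemma cubic_no_poly_root (r : {poly L}) :
  r ^+ 3 + b%:P * 'X^2 * r + ('X^6 + 1) != 0.
Proof.
apply/eqP => E.
have sr : (size r <= 3)%N.
  rewrite leqNgt; apply/negP => sr.
  have r0 : r != 0 by rewrite -size_poly_gt0; apply: leq_trans sr.
  have : size (r ^+ 3) = size (- (b%:P * 'X^2 * r + ('X^6 + 1))).
    suff -> : r ^+ 3 = - (b%:P * 'X^2 * r + ('X^6 + 1)) by [].
    by apply/eqP; rewrite -addr_eq0 addrA E.
  move=> sE; have := size_exp r 3; rewrite sE size_polyN.
  have : (size (b%:P * 'X^2 * r + ('X^6 + 1))%R <= maxn (size r).+2 7)%N.
    apply: (leq_trans (size_polyD _ _)); rewrite geq_max !leq_max.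
    rewrite -mulrA mul_polyC (leq_trans (size_scale_leq _ _)) ?size_XnsubC //.
      by rewrite -[1]polyC1 size_XnaddC // leqnn orbT.
    by rewrite mulrC size_mulXn // addn2.
  move: sr (size _) => + N; move: (size r) => m; rewrite leq_max; lia.
have rE : r = r`_2 *: 'X^2 + r`_1 *: 'X + (r`_0)%:P.
  apply/polyP => i; rewrite !coefE.
  case: i => [|[|[|i]]]; rewrite /= ?(mulr0, mulr1, addr0, add0r) //.
  by rewrite nth_default // (leq_trans sr).
move: (r`_2) (r`_1) (r`_0) rE => u v w rE.
have {E} : (u ^+ 3 + 1) *: 'X^6 + (3%:R * u ^+ 2 * v) *: 'X^5
   + (3%:R * u ^+ 2 * w + 3%:R * u * v ^+ 2 + b * u) *: 'X^4
   + (v ^+ 3 + 6%:R * u * v * w + b * v) *: 'X^3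
   + (3%:R * u * w ^+ 2 + 3%:R * v ^+ 2 * w + b * w) *: 'X^2
   + (3%:R * v * w ^+ 2) *: 'X + (w ^+ 3 + 1)%:P = 0.
  rewrite -E rE -!mul_polyC !(rmorphD, rmorphM, rmorphXn, rmorph_nat, rmorph1) /=.
  by ring.
move=> E; have co i := congr1 (fun p : {poly L} => p`_i) E.
move: (co 6%N) (co 5%N) (co 4%N) (co 0%N); rewrite !coefE /=.
rewrite !(mulr0, mulr1, addr0, add0r) => e6 e5 e4 e0.
have u0 : u != 0.
  by apply: contra_eq_neq e6 => ->; rewrite expr0n add0r oner_eq0.
have v0 : v = 0.
  by apply/eqP; move/eqP: e5; rewrite !mulf_eq0 (negPf three0) !(negPf u0) /=.
have bE : b = - (3%:R * u * w).
  apply: (mulfI u0); move: e4; rewrite v0 expr0n mulr0 addr0.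
  by move/eqP; rewrite addrC addr_eq0 mulrC => /eqP ->; ring.
case/eqP: b0; rewrite bE.
have u3 : u ^+ 3 = -1 by apply/eqP; rewrite -addr_eq0 e6.
have w3 : w ^+ 3 = -1 by apply/eqP; rewrite -addr_eq0 e0.
rewrite (_ : _ + _ = 27%:R * (1 - u ^+ 3 * w ^+ 3)); last by ring.
by rewrite u3 w3 mulrNN mulr1 subrr mulr0.
Qed.

(** If Y^6 + 1 = - r^2, then r divides both Y^6 + 1 and its derivative 6 Y^5,
   hence the constant 1. *)
Lemma sextic_not_square (r : {poly L}) : r ^+ 2 + ('X^6 + 1) != 0.
Proof.
apply/eqP => E; have pE : 'X^6 + 1 = - r ^+ 2 by apply/eqP; rewrite -addr_eq0 addrC E.
have sp : size ('X^6 + 1 : {poly L}) = 7 by rewrite -[1]polyC1 size_XnaddC.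
have : r %| 1.
  have -> : (1 : {poly L}) = ('X^6 + 1) - (6%:R^-1)%:P * 'X * ('X^6 + 1)^`().
    have -> : ('X^6 + 1 : {poly L})^`() = (6%:R)%:P * 'X^5.
      by rewrite !derivE addr0 /= polyC_natr mulr_natl.
    rewrite mulrACA -polyCM mulVf // mul1r -exprS addrAC subrr.
    by rewrite add0r.
  rewrite pE expr2 !derivE; apply: dvdp_add; first by rewrite dvdpNr dvdp_mull.
  rewrite dvdpNr dvdp_mull // dvdpNr; apply: dvdp_add; [exact: dvdp_mull | exact: dvdp_mulr].
rewrite dvdp1 => /size_poly1P [c _ rc].
by move: sp; rewrite pE rc -polyC_exp size_polyN size_polyC; case: (_ != 0).
Qed.

End Sextic.

Section EvenNorm.
Variable F : fieldType.
Implicit Types p q g : {poly F}.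

(** The norm from F[X] to F[X^2], read in the variable X^2: for
   p = A(X^2) + X B(X^2) it is (A^2 - X B^2)(X^2) = p(X) p(-X). *)
Definition even_norm p := even_poly p ^+ 2 - 'X * odd_poly p ^+ 2.

Lemma even_norm_comp p : even_norm p \Po 'X^2 = p * (p \Po - 'X).
Proof.
have E := poly_even_odd p.
rewrite -[in RHS]E /even_norm comp_polyB comp_polyD !comp_polyM !comp_polyX.
rewrite -!comp_polyA !comp_Xn_poly sqrrN.
by ring.
Qed.

Lemma comp_polyX2_inj : injective (fun p => p \Po 'X^2).
Proof.
move=> p q /= /eqP; rewrite -subr_eq0 -comp_polyB comp_poly_eq0 ?size_polyXn //.
by rewrite subr_eq0 => /eqP.
Qed.

Lemma even_normM p q : even_norm (p * q) = even_norm p * even_norm q.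
Proof.
apply: comp_polyX2_inj; rewrite comp_polyM !even_norm_comp comp_polyM.
by ring.
Qed.

Lemma even_norm_even g : even_norm (g \Po 'X^2) = g ^+ 2.
Proof.
apply: comp_polyX2_inj; rewrite even_norm_comp -comp_polyA comp_Xn_poly sqrrN.
by rewrite expr2 comp_polyM.
Qed.

Lemma size_even_norm p : size (even_norm p) = size p.
Proof.
have [->|p0] := eqVneq p 0.
  by rewrite /even_norm even_polyC odd_polyC expr0n mulr0 subr0.
have := congr1 (fun p : {poly F} => size p) (even_norm_comp p).
have sX : size (- 'X : {poly F}) = 2 by rewrite size_polyN size_polyX.
have n0 : even_norm p != 0.
  apply/eqP => h; have := even_norm_comp p; rewrite h comp_poly0 => /esym/eqP.
  by rewrite mulf_eq0 comp_poly2_eq0 // orbb (negPf p0).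
move/(congr1 predn); rewrite /= size_comp_poly size_polyXn size_mul ?comp_poly2_eq0 //.
rewrite size_comp_poly2 //.
move: p0 n0; rewrite -!size_poly_gt0; move: (size _) (size _) => m n; lia.
Qed.

Lemma lead_coef_even_norm p :
  lead_coef (even_norm p) = (-1) ^+ (size p).-1 * lead_coef p ^+ 2.
Proof.
have := congr1 lead_coef (even_norm_comp p).
rewrite lead_coefM !lead_coef_comp ?size_polyXn ?size_polyN ?size_polyX //.
rewrite lead_coefXn expr1n mulr1 lead_coefN lead_coefX => ->.
by ring.
Qed.

Lemma even_norm0 p : (even_norm p).[0] = p.[0] ^+ 2.
Proof.
have := congr1 (fun p => p.[0]) (even_norm_comp p).
by rewrite /= hornerM !horner_comp hornerXn hornerN hornerX oppr0 expr0n /= -expr2.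
Qed.

(** The norms of the factors of g(X^2) multiply to g^2. As g is irreducible, a
   proper factor G has norm m g with m constant. As the degree of g is odd,
   m = - lc(G)^2, so the value at 0 makes - g(0) the square of G(0) / lc(G). *)
Lemma irreducible_comp_X2 g :
  g \is monic -> ~~ odd (size g) -> irreducible_poly g ->
  (forall r, r ^+ 2 != - g.[0]) -> irreducible_poly (g \Po 'X^2).
Proof.
move=> gm go gi nsq; have g0 := monic_neq0 gm.
have sf : size (g \Po 'X^2) = ((size g).-1 * 2).+1.
  have := size_comp_poly g 'X^2; rewrite size_polyXn /= => <-.
  by rewrite prednK // size_poly_gt0 comp_poly_eq0 // size_polyXn.
split; first by rewrite sf; case: gi; move: (size g) => m; lia.
move=> G sG /dvdpP [H fE].
have f0 : g \Po 'X^2 != 0 by rewrite -size_poly_gt0 sf.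
have [H0 G0] : H != 0 /\ G != 0.
  by apply/andP; rewrite -negb_or -mulf_eq0 -fE.
have nE : g ^+ 2 = even_norm H * even_norm G by rewrite -even_normM -fE even_norm_even.
have gG : g %| even_norm G.
  apply: contraNT sG => ngG; rewrite -size_even_norm.
  rewrite -irreducible_poly_coprime // in ngG.
  have : even_norm G %| g ^+ 2 by rewrite nE dvdp_mull.
  rewrite -[X in X %| _]mul1r -[X in _ %| X]mulr1 => h.
  have : coprimep (even_norm G) (g ^+ 2) by rewrite coprimep_expr // coprimep_sym.
  move/coprimepP/(_ (even_norm G) (dvdpp _)); rewrite mul1r mulr1 in h => /(_ h).
  by rewrite -size_poly_eq1.
have [m mE] := dvdpP _ _ gG.
have gE : g = even_norm H * m.
  by apply: (mulIf g0); rewrite -expr2 nE mE mulrA.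
have m0 : m != 0 by apply: contraNneq g0 => h; rewrite gE h mulr0.
have [sH|sH] := eqVneq (size H) 1.
  have/size_poly1P[c c0 HE]: size H == 1 by rewrite sH.
  by rewrite fE HE mul_polyC eqp_sym eqp_scale.
have : even_norm H %= g.
  by apply: (apply_irredp gi); rewrite ?size_even_norm // gE dvdp_mulr.
move=> /eqp_size; rewrite [in RHS]gE size_mul ?even_norm_neq0 //; last first.
  by rewrite -size_poly_gt0 size_even_norm size_poly_gt0.
rewrite size_even_norm => sm.
have {sm} sm : size m == 1%N.
  by move: H0 m0 sm; rewrite -!size_poly_gt0; move: (size _) (size _) => u v; lia.
have /size_poly1P [c c0 mE'] := sm.
rewrite mE' mul_polyC in mE.
have sGg : size G = size g by rewrite -(size_even_norm G) mE size_scale.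
have := lead_coef_even_norm G; rewrite mE lead_coefZ (monicP gm) mulr1 sGg.
have -> : (-1) ^+ (size g).-1 = -1 :> F.
  have sg : (0 < size g)%N by rewrite size_poly_gt0.
  rewrite -signr_odd; have -> // : odd (size g).-1 = true.
  by move: go; case: (size g) sg => // n _ /=; case: odd.
rewrite mulN1r => cE.
have := even_norm0 G; rewrite mE hornerZ cE => gE0.
have lG : lead_coef G != 0 by rewrite lead_coef_eq0.
have/eqP[] := nsq (G.[0] / lead_coef G).
by rewrite expr_div_n -gE0; field.
Qed.
End EvenNorm.

Section SexticIrreducible.
Variables (L : fieldType) (b : L).
Hypotheses (six0 : 6%:R != 0 :> L) (b0 : b ^+ 3 + 27%:R != 0).
Local Notation iF := (@FracField.tofrac {poly L}).

(** The equation as a polynomial in X^2. *)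
Definition cubic_model : {poly {poly L}} :=
  'X^3 + (b%:P * 'X^2)%:P * 'X + ('X^6 + 1)%:P.

Lemma cubic_model_horner s :
  cubic_model.[s] = s ^+ 3 + b%:P * 'X^2 * s + ('X^6 + 1).
Proof. by rewrite /cubic_model !hornerD hornerXn hornerM !hornerC hornerX. Qed.

Lemma cubic_modelE : U_eqn b = cubic_model \Po 'X^2.
Proof.
rewrite /U_eqn /cubic_model !comp_polyD !comp_polyM !comp_polyC !comp_polyX.
rewrite !(polyC_exp, polyCD, polyCM, polyC1).
by ring.
Qed.

Lemma size_cubic_model : size cubic_model = 4.
Proof.
rewrite /cubic_model -addrA size_polyDl size_polyXn //.
rewrite mul_polyC; apply: (leq_ltn_trans (size_polyD _ _)).
rewrite gtn_max (leq_ltn_trans (size_scale_leq _ _)) ?size_polyX //=.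
by apply: leq_ltn_trans (size_polyC_leq1 _) _.
Qed.

Lemma cubic_model_monic : cubic_model \is monic.
Proof.
rewrite monicE lead_coefE size_cubic_model /= !coefE /=.
by rewrite !(mulr0, addr0).
Qed.

Lemma tofrac_inj : injective iF.
Proof. by move=> x y /eqP; rewrite tofrac_eq => /eqP. Qed.

Lemma cubic_model_irreducible : irreducible_poly (map_poly iF cubic_model).
Proof.
apply: cubic_irreducible.
  by rewrite size_map_inj_poly ?size_cubic_model //; exact: tofrac_inj.
move=> r; apply/negP => rr.
have [s rE] := fraction_poly_integral cubic_model_monic rr.
move: rr; rewrite rE /root horner_map tofrac_eq0 cubic_model_horner => E.
by have := cubic_no_poly_root six0 b0 s; rewrite E.
Qed.

Lemma sextic_fraction_irreducible : irreducible_poly (map_poly iF (U_eqn b)).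
Proof.
rewrite cubic_modelE map_comp_poly map_polyXn.
apply: irreducible_comp_X2.
- exact: monic_map cubic_model_monic.
- by rewrite size_map_inj_poly ?size_cubic_model //; exact: tofrac_inj.
- exact: cubic_model_irreducible.
move=> r; apply/negP => /eqP rE.
have pm : 'X^2 + ('X^6 + 1)%:P \is @monic {poly L} by rewrite monicXnaddC.
have [|s sE] := @fraction_poly_integral L _ r pm.
  apply/rootP; rewrite rmorphD /= map_polyXn map_polyC hornerD hornerXn hornerC.
  rewrite rE -(rmorph0 iF) horner_map cubic_model_horner.
  by rewrite expr0n mulr0 !add0r addNr.
move: rE; rewrite sE -(rmorph0 iF) horner_map cubic_model_horner.
rewrite expr0n mulr0 !add0r -tofracXn -tofracN => /tofrac_inj E.
by have := sextic_not_square six0 s; rewrite E addNr eqxx.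
Qed.

Lemma sextic_monic : U_eqn b \is monic.
Proof.
by rewrite cubic_modelE monicE lead_coef_comp ?size_polyXn // lead_coefXn
  expr1n mulr1 -monicE cubic_model_monic.
Qed.

Lemma size_sextic : size (U_eqn b) = 7.
Proof.
have := size_comp_poly cubic_model 'X^2.
rewrite -cubic_modelE size_polyXn size_cubic_model /=.
by case: (size _) => // n /= ->.
Qed.

(** Over L[Y] a factorisation could also contain a constant of L[Y], but the
   equation is monic, so such a constant is a unit. *)
Lemma sextic_irreducible : irreducible_element (U_eqn b).
Proof.
split.
- exact: monic_neq0 sextic_monic.
- by rewrite poly_unitE size_sextic.
move=> g h fE; have [_ irr] := sextic_fraction_irreducible.
have [g0 h0] : g != 0 /\ h != 0.
  by apply/andP; rewrite -negb_or -mulf_eq0 -fE monic_neq0 // sextic_monic.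
have lE : lead_coef g * lead_coef h = 1.
  by rewrite -lead_coefM -fE (monicP sextic_monic).
have lg : lead_coef g \is a GRing.unit.
  by apply/unitrPr; exists (lead_coef h).
have lh : lead_coef h \is a GRing.unit.
  by apply/unitrPr; exists (lead_coef g); rewrite mulrC.
have const (q : {poly {poly L}}) : size q == 1 -> lead_coef q \is a GRing.unit ->
    q \is a GRing.unit.
  move=> q1; rewrite [in lead_coef q](@size1_polyC _ q) ?(eqP q1) // lead_coefC => uq.
  by rewrite (@size1_polyC _ q) ?(eqP q1) //; apply: rmorph_unit.
have [sg|sg] := eqVneq (size g) 1; first by left; apply: const; rewrite ?sg.
right; apply: const => //.
have inj := @tofrac_inj.
have /eqp_size : map_poly iF g %= map_poly iF (U_eqn b).
  by apply: irr; rewrite ?size_map_inj_poly // fE rmorphM dvdp_mulr.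
rewrite !size_map_inj_poly // fE size_mul // => E.
by move: g0 h0 E; rewrite -!size_poly_gt0; move: (size _) (size _) => u v; lia.
Qed.

End SexticIrreducible.

Lemma base_change_U_eqn (R S : nzRingType) (j : {rmorphism R -> S}) (b : R) :
  base_change j (U_eqn b) = U_eqn (j b).
Proof.
rewrite /base_change /U_eqn !(rmorphD, rmorphM, rmorphXn, rmorph1) /=.
by rewrite !(map_polyX, map_polyC) /= !map_polyC /= map_polyX.
Qed.

Lemma sextic_geometrically_irreducible (k : fieldType) (b : k) :
  6%:R != 0 :> k -> b ^+ 3 + 27%:R != 0 -> geometrically_irreducible (U_eqn b).
Proof.
move=> six0 b0 L j; rewrite base_change_U_eqn; apply: sextic_irreducible.
  by rewrite -(rmorph_nat j) fmorph_eq0.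
by rewrite -rmorphXn -(rmorph_nat j) -rmorphD fmorph_eq0.
Qed.

(** * The function field of a monic irreducible equation *)

Section Evaluation.
Variables (k : nzRingType) (K : comNzRingType) (iota : {rmorphism k -> K}) (x y : K).

Definition eval2 (g : {poly {poly k}}) : K := (base_change iota g).[x, y].

Fact eval2_is_zmod_morphism : zmod_morphism eval2.
Proof. by move=> g h; rewrite /eval2 /base_change rmorphB /= !hornerE. Qed.

Fact eval2_is_monoid_morphism : monoid_morphism eval2.
Proof.
split=> [|g h]; rewrite /eval2 /base_change.
  by rewrite rmorph1 !hornerE.
by rewrite rmorphM /= !hornerM.
Qed.

HB.instance Definition _ :=
  GRing.isZmodMorphism.Build {poly {poly k}} K eval2 eval2_is_zmod_morphism.
HB.instance Definition _ :=
  GRing.isMonoidMorphism.Build {poly {poly k}} K eval2 eval2_is_monoid_morphism.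

Lemma eval2B g h : eval2 (g - h) = eval2 g - eval2 h.
Proof. exact: rmorphB. Qed.

Lemma eval2D g h : eval2 (g + h) = eval2 g + eval2 h.
Proof. exact: rmorphD. Qed.

Lemma eval2M g h : eval2 (g * h) = eval2 g * eval2 h.
Proof. exact: rmorphM. Qed.

Lemma eval2_exp g n : eval2 (g ^+ n) = eval2 g ^+ n.
Proof. exact: rmorphXn. Qed.

Lemma eval2_nat n : eval2 n%:R = n%:R.
Proof. exact: rmorph_nat. Qed.

Lemma eval2X : eval2 'X = x.
Proof. by rewrite /eval2 /base_change map_polyX !hornerE. Qed.

Lemma eval2C (c : {poly k}) : eval2 c%:P = (map_poly iota c).[y].
Proof. by rewrite /eval2 /base_change map_polyC hornerC. Qed.

Lemma eval2Y : eval2 'Y = y.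
Proof. by rewrite eval2C map_polyX hornerX. Qed.

Lemma eval2CC (c : k) : eval2 c%:P%:P = iota c.
Proof. by rewrite eval2C map_polyC hornerC. Qed.

(** Evaluation is the only morphism with these values on the generators; this
   identifies compositions of morphisms with evaluations. *)
Lemma eval2_unique (phi : {rmorphism {poly {poly k}} -> K}) :
  phi 'X = x -> phi 'Y = y -> (forall c, phi c%:P%:P = iota c) -> phi =1 eval2.
Proof.
move=> pX pY pC; elim/poly_ind => [|g c IH]; first by rewrite !rmorph0.
rewrite !rmorphD !rmorphM /= pX eval2X IH; congr (_ + _).
elim/poly_ind: c {IH} => [|c a IH]; first by rewrite !rmorph0.
by rewrite !polyCD !polyCM !rmorphD !rmorphM /= IH pC pY eval2Y eval2CC.
Qed.
End Evaluation.

Section Existence.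
Variables (k : fieldType) (f : {poly {poly k}}).
Local Notation iF := (@FracField.tofrac {poly k}).
Hypotheses (fm : f \is monic) (firr : irreducible_poly (map_poly iF f)).

(** Division with remainder by the monic f takes place over k[Y], so divisibility
   over k(Y) already holds over k[Y]. *)
Lemma dvdp_fraction g : map_poly iF f %| map_poly iF g -> exists h, g = h * f.
Proof.
move=> fg; have gE := Pdiv.RingMonic.rdivp_eq fm g.
set q := Pdiv.CommonRing.rdivp g f in gE; set r := Pdiv.CommonRing.rmodp g f in gE.
have sr : (size r < size f)%N by rewrite Pdiv.CommonRing.ltn_rmodp monic_neq0.
suff r0 : r = 0 by exists q; rewrite gE r0 addr0.
have : map_poly iF f %| map_poly iF r.
  by rewrite gE rmorphD rmorphM /= dvdp_addr ?dvdp_mull in fg.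
apply: contraTeq => r0; apply/negP => /dvdp_leq.
rewrite map_poly_eq0_id0 ?lead_coef_eq0 // => [/(_ r0)|]; last first.
  by rewrite tofrac_eq0 lead_coef_eq0.
by rewrite !size_map_inj_poly ?rmorph0 //; [rewrite leqNgt sr | exact: tofrac_inj..].
Qed.

Lemma clear_denominators (p : {poly {fraction {poly k}}}) :
  exists d g, d != 0 /\ (iF d)%:P * p = map_poly iF g.
Proof.
elim/poly_ind: p => [|p r [d [g [d0 E]]]].
  by exists 1, 0; rewrite oner_eq0 mulr0 rmorph0.
have [n [e [e0 rE]]] := fraction_div r.
exists (d * e), (e%:P * g * 'X + (d * n)%:P); split; first by rewrite mulf_neq0.
have eF : iF e != 0 by rewrite tofrac_eq0.
have RE : (iF e)%:P * r%:P = (iF n)%:P by rewrite -polyCM rE mulrC divfK.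
rewrite rmorphD !rmorphM /= map_polyX !map_polyC /= -E -RE.
have aux (S : comNzRingType) (D E' P X C : S) :
  D * E' * (P * X + C) = E' * (D * P) * X + D * (E' * C) by ring.
exact: aux.
Qed.

(** The Bezout identity over k(Y), cleared of denominators. *)
Lemma elimination g : ~ (exists h, g = h * f) ->
  exists u v c, c != 0 /\ c%:P = u * g + v * f.
Proof.
move=> ng; have : coprimep (map_poly iF f) (map_poly iF g).
  by rewrite irreducible_poly_coprime //; apply/negP => /dvdp_fraction.
case/Bezout_eq1_coprimepP => -[v u] /= E.
have [d [v' [d0 vE]]] := clear_denominators v.
have [e [u' [e0 uE]]] := clear_denominators u.
exists (d%:P * u'), (e%:P * v'), (d * e); split; first by rewrite mulf_neq0.
apply: (map_inj_poly (@tofrac_inj k)); first by rewrite rmorph0.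
rewrite rmorphD !rmorphM /= !map_polyC /= -vE -uE.
have aux (S : comNzRingType) (D A U B V C : S) : V * C + U * B = 1 ->
    D * A = D * (A * U) * B + A * (D * V) * C.
  by move=> h; rewrite -[LHS]mulr1 -h; ring.
exact: aux.
Qed.

Let hI : monic_irreducible_poly (map_poly iF f).
Proof. by split=> //; exact: monic_map. Qed.

Let K : fieldType := {poly %/ map_poly iF f with hI}.
Let pi : {rmorphism {poly {fraction {poly k}}} -> K} := in_qpoly (map_poly iF f).

Let pi_eq0 p : pi p = 0 <-> map_poly iF f %| p.
Proof.
have E : val (pi p) = p %% map_poly iF f.
  by rewrite /= mk_monicE // -Pdiv.IdomainMonic.modpE ?hI.
split=> [p0|]; first by apply/modp_eq0P; rewrite -E p0.
by move/modp_eq0P => h; apply: val_inj; rewrite E h.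
Qed.

Let phi : {rmorphism {poly {poly k}} -> K} := pi \o map_poly iF.
Let iota : {rmorphism k -> K} := phi \o (polyC \o polyC).

(** The function field is k(Y)[X] / (f), with x and y the classes of X and Y. *)
Lemma plane_curve_exists : geometrically_irreducible f -> inhabited (plane_curve f).
Proof.
move=> gi; constructor.
have ev g : (base_change iota g).[phi 'X, phi 'Y] = phi g.
  by apply: esym; apply: (@eval2_unique k K iota (phi 'X) (phi 'Y) phi).
apply: (@PlaneCurve k f K iota (phi 'X) (phi 'Y)) => // [g|z].
  rewrite ev; split=> [/pi_eq0 /dvdp_fraction //|[h ->]].
  by apply/pi_eq0; rewrite rmorphM dvdp_mull.
have [d [g [d0 E]]] := clear_denominators (val z).
exists g, d%:P; rewrite !ev.
have phid : phi d%:P != 0.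
  apply/eqP => /pi_eq0 /dvdp_fraction [h hE].
  have := congr1 (fun p : {poly _} => size p) hE.
  have h0 : h != 0 by apply: contraNneq d0 => h0; rewrite -polyC_eq0 hE h0 mul0r.
  rewrite size_Mmonic // size_polyC d0.
  have [sf _] := firr; rewrite size_map_inj_poly ?rmorph0 // in sf; last exact: tofrac_inj.
  by move: h0 sf; rewrite -size_poly_gt0; move: (size _) (size _) => u v /=; lia.
split=> //; apply: (mulIf phid); rewrite divfK //.
have zE : z = pi (val z).
  by apply: val_inj; rewrite [RHS]in_qpoly_small // size_mk_monic.
rewrite mulrC zE /phi /= -E rmorphM map_polyC //.
Qed.

End Existence.

(** * Valuation rings and plane coordinates *)

Section ValuationRings.
Local Open Scope classical_set_scope.
Local Open Scope ring_scope.
Variables (k : finFieldType) (K : fieldType) (iota : {rmorphism k -> K}).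
Variables (O : set K) (vO : valuation_ring iota O).

Lemma valuation_ring1 : O 1.
Proof. by rewrite -(rmorph1 iota); apply: valuation_ring_const. Qed.

Lemma valuation_ring0 : O 0.
Proof. by rewrite -(rmorph0 iota); apply: valuation_ring_const. Qed.

Lemma valuation_ringN u : O u -> O (- u).
Proof.
by rewrite -sub0r; move=> Ou; apply: (valuation_ring_sub vO) => //; apply: valuation_ring0. Qed.

Lemma valuation_ringD u v : O u -> O v -> O (u + v).
Proof.
move=> Ou Ov; rewrite -[v]opprK.
by apply: (valuation_ring_sub vO) => //; apply: valuation_ringN. Qed.

Lemma valuation_ringX u n : O u -> O (u ^+ n).
Proof.
move=> Ou; elim: n => [|n IH]; first by rewrite expr0; apply: valuation_ring1.
by rewrite exprS; apply: (valuation_ring_mul vO).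
Qed.

Lemma maximal_idealN1 : ~ maximal_ideal O 1.
Proof. by case=> _ [/eqP|]; rewrite ?oner_eq0 ?invr1 => // /(_ valuation_ring1). Qed.

Lemma unit_notin_maximal u : O u -> ~ maximal_ideal O u -> u != 0 /\ O u^-1.
Proof.
move=> Ou mu; split; first by apply/eqP => u0; apply: mu; split=> //; left.
by apply: contrapT => h; apply: mu; split=> //; right.
Qed.

Lemma maximal_ideal_mul u v : O u -> maximal_ideal O v -> maximal_ideal O (u * v).
Proof.
move=> Ou [Ov mv]; split; first exact: (valuation_ring_mul vO).
have [->|u0] := eqVneq u 0; first by left; rewrite mul0r.
case: mv => [->|mv]; first by left; rewrite mulr0.
right=> h; apply: mv; have -> : v^-1 = u * (u * v)^-1 by rewrite invfM mulrA divff ?mul1r.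
exact: (valuation_ring_mul vO).
Qed.

Lemma maximal_idealD u v :
  maximal_ideal O u -> maximal_ideal O v -> maximal_ideal O (u + v).
Proof.
move=> mu mv.
wlog Ouv : u v mu mv / O (u / v).
  move=> W; case: (valuation_ring_total vO (u / v)) => h; first exact: W.
  by rewrite addrC; apply: W => //; rewrite invf_div in h.
have [v0|v0] := eqVneq v 0; first by rewrite v0 addr0.
have -> : u + v = (u / v + 1) * v by rewrite mulrDl divfK ?mul1r.
by apply: maximal_ideal_mul => //; apply: valuation_ringD => //; apply: valuation_ring1.
Qed.

Lemma maximal_ideal_prime u v : O u -> O v ->
  maximal_ideal O (u * v) -> maximal_ideal O u \/ maximal_ideal O v.
Proof.
move=> Ou Ov mw; apply: contrapT => /not_orP [mu mv].
have [u0 Ou'] := unit_notin_maximal Ou mu.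
apply: mv; have -> : v = u^-1 * (u * v) by rewrite mulrA mulVf ?mul1r.
exact: maximal_ideal_mul.
Qed.

End ValuationRings.

Section Subring.
Variables (k : nzRingType) (K : comNzRingType) (iota : {rmorphism k -> K}) (x y : K).

Lemma eval2_closed (S : K -> Prop) :
  (forall u v, S u -> S v -> S (u + v)) -> (forall u v, S u -> S v -> S (u * v)) ->
  (forall c, S (iota c)) -> S x -> S y -> forall g, S (eval2 iota x y g).
Proof.
move=> SD SM Sc Sx Sy; have S0 : S 0 by rewrite -(rmorph0 iota).
have SC (c : {poly k}) : S (eval2 iota x y c%:P).
  elim/poly_ind: c => [|c a IH]; first by rewrite !rmorph0.
  rewrite polyCD polyCM rmorphD rmorphM /= eval2Y eval2CC.
  by apply: SD => //; apply: SM.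
elim/poly_ind=> [|g c IH]; first by rewrite rmorph0.
by rewrite rmorphD rmorphM /= eval2X; apply: SD => //; apply: SM.
Qed.

Lemma eval2_swapXY g : eval2 iota y x (swapXY g) = eval2 iota x y g.
Proof.
have := @eval2_unique k K iota x y (eval2 iota y x \o @swapXY k); apply=> /=.
- by rewrite swapXY_X eval2Y.
- by rewrite swapXY_Y eval2X.
- by move=> c; rewrite swapXY_polyC map_polyC /= eval2CC.
Qed.
End Subring.

Section Coordinates.
Variables (k : finFieldType) (K : fieldType) (iota : {rmorphism k -> K}) (c : k).
Hypotheses (six0 : 6%:R != 0 :> k) (c0 : c ^+ 3 + 27%:R != 0).
Local Notation f := (U_eqn c).
Local Notation R2 := {poly {poly k}}.

(** Pairs of functions that may serve as x and y in a plane curve with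
   equation f. The notion is stated for arbitrary pairs because the same field
   is seen below through several pairs of coordinates. *)
Definition coordinates (x y : K) : Prop :=
  (forall g : R2, eval2 iota x y g = 0 <-> exists h, g = h * f) /\
  (forall z, exists g h : R2, eval2 iota x y h != 0 /\
     z = eval2 iota x y g / eval2 iota x y h).

Lemma swapXY_sextic : swapXY f = f.
Proof.
rewrite /U_eqn !(rmorphD, rmorphM, rmorphXn, rmorph1) /=.
rewrite swapXY_X swapXY_Y swapXY_polyC map_polyC /=.
by ring.
Qed.

Lemma eval2_sextic x y : eval2 iota x y f = x ^+ 6 + y ^+ 6 + 1 + iota c * x ^+ 2 * y ^+ 2.
Proof.
by rewrite /U_eqn !(rmorphD, rmorphM, rmorphXn, rmorph1) /= eval2X eval2Y eval2CC.
Qed.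

Lemma polyC_not_multiple (C : {poly k}) : C != 0 -> ~ exists h, C%:P = h * f.
Proof.
move=> C0 [h hE]; have h0 : h != 0.
  by apply: contraNneq C0 => h0; rewrite -polyC_eq0 hE h0 mul0r.
have := congr1 (fun p : {poly _} => size p) hE.
rewrite size_Mmonic ?sextic_monic // size_sextic size_polyC C0.
by rewrite -size_poly_gt0 in h0; move: h0; move: (size _) => n; lia.
Qed.

Lemma sextic_elimination g : ~ (exists h, g = h * f) ->
  exists u v (C : {poly k}), C != 0 /\ C%:P = u * g + v * f.
Proof.
apply: elimination; first exact: sextic_monic.
exact: sextic_fraction_irreducible.
Qed.

Lemma coordinates_swap x y : coordinates x y -> coordinates y x.
Proof.
move=> [ker gen]; split=> [g|z].
  rewrite -eval2_swapXY ker; split=> -[h hE]; exists (swapXY h).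
    by rewrite -[LHS]swapXYK hE rmorphM /= swapXY_sextic.
  by rewrite hE rmorphM /= swapXY_sextic.
have [g [h [h0 zE]]] := gen z.
by exists (swapXY g), (swapXY h); rewrite !eval2_swapXY.
Qed.

Section Fixed.
Variables (x y : K) (xy : coordinates x y).
Local Notation ev := (eval2 iota x y).

Lemma coordinates_eq : ev f = 0.
Proof. by apply/xy.1; exists 1; rewrite mul1r. Qed.

Lemma y_transcendental (C : {poly k}) : C != 0 -> (map_poly iota C).[y] != 0.
Proof.
by move=> C0; apply/eqP; rewrite -(eval2C iota x y) => /xy.1; apply: polyC_not_multiple.
Qed.

Lemma coordinate_y_neq0 : y != 0.
Proof.
have := @y_transcendental 'X; rewrite polyX_eq0 map_polyX hornerX; exact.
Qed.

(** The pair (x/y, 1/y) satisfies the same equation because the homogenisation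
   of f is symmetric in the three variables. A relation that is not a multiple
   of f would make 1/y, hence y, algebraic over k. *)
Lemma coordinates_infinity : coordinates (x / y) y^-1.
Proof.
have y0 := coordinate_y_neq0.
have f0 : eval2 iota (x / y) y^-1 f = 0.
  have : ev f = 0 := coordinates_eq.
  rewrite !eval2_sextic => E.
  have -> : (x / y) ^+ 6 + y^-1 ^+ 6 + 1 + iota c * (x / y) ^+ 2 * y^-1 ^+ 2 =
    y^-1 ^+ 6 * (x ^+ 6 + y ^+ 6 + 1 + iota c * x ^+ 2 * y ^+ 2) by field.
  by rewrite E mulr0.
split=> [g|z].
  split=> [g0|[h ->]]; last by rewrite rmorphM /= f0 mulr0.
  apply: contrapT => /sextic_elimination [u [v [C [C0 CE]]]].
  have : eval2 iota (x / y) y^-1 C%:P = 0.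
    by rewrite CE rmorphD !rmorphM /= g0 f0 !mulr0 addr0.
  rewrite eval2C => E.
  (* The reciprocal polynomial of C, which has the root y. *)
  pose D : {poly k} := \poly_(i < size C) C`_(size C - i.+1).
  have D0 : D != 0.
    apply/eqP => D0; move: (coef0 k 0); rewrite -D0 coef_poly size_poly_gt0 C0.
    by rewrite subn1 -lead_coefE => /eqP; rewrite lead_coef_eq0 (negPf C0).
  case/eqP: (y_transcendental D0).
  rewrite (@horner_coef_wide _ (size C)); last by rewrite size_map_poly size_poly.
  transitivity (y ^+ (size C).-1 * (map_poly iota C).[y^-1]); last by rewrite E mulr0.
  rewrite (@horner_coef_wide _ (size C)); last by rewrite size_map_poly.
  rewrite mulr_sumr [RHS](reindex_inj rev_ord_inj) /=. apply: eq_bigr => i _.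
  rewrite !coef_map coef_poly ltn_ord /= mulrCA; congr (_ * _).
  rewrite exprVn; have -> : ((size C).-1 = i + (size C - i.+1))%N.
    by move: (ltn_ord i); move: (size C) (nat_of_ord i) => a b; lia.
  by rewrite exprD mulfK // expf_neq0.
pose ev' := eval2 iota (x / y) y^-1.
have fr g : exists g' h', ev' h' != 0 /\ ev g = ev' g' / ev' h'.
  apply: (@eval2_closed k K iota x y
    (fun z => exists g' h', ev' h' != 0 /\ z = ev' g' / ev' h')).
  - move=> _ _ [g1 [h1 [n1 ->]]] [g2 [h2 [n2 ->]]].
    exists (g1 * h2 + g2 * h1), (h1 * h2); rewrite /ev' rmorphD !rmorphM /=.
    by rewrite mulf_neq0 // addf_div.
  - move=> _ _ [g1 [h1 [n1 ->]]] [g2 [h2 [n2 ->]]].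
    exists (g1 * g2), (h1 * h2); rewrite /ev' !rmorphM /=.
    by rewrite mulf_neq0 // mulf_div.
  - by move=> a; exists a%:P%:P, 1; rewrite /ev' rmorph1 oner_eq0 divr1 eval2CC.
  - by exists 'X, 'Y; rewrite /ev' eval2X eval2Y invr_eq0 y0 invrK divfK.
  - by exists 1, 'Y; rewrite /ev' rmorph1 eval2Y invr_eq0 y0 invrK mul1r.
have [g [h [h0 ->]]] := xy.2 z.
have [g1 [h1 [n1 gE]]] := fr g; have [g2 [h2 [n2 hE]]] := fr h.
have g20 : ev' g2 != 0.
  by apply: contraNneq h0 => e; rewrite hE e mul0r.
exists (g1 * h2), (h1 * g2); rewrite -/ev gE hE.
by rewrite !rmorphM /= mulf_neq0 // invf_div mulf_div.
Qed.

End Fixed.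
End Coordinates.

(** * Closed points of the affine curve *)

Section PrimeIdeals.
Local Open Scope classical_set_scope.
Local Open Scope ring_scope.
Variables (k : finFieldType) (c : k).
Hypotheses (six0 : 6%:R != 0 :> k) (c0 : c ^+ 3 + 27%:R != 0).
Local Notation f := (U_eqn c).
Local Notation R2 := {poly {poly k}}.

(** The nonzero prime ideals of the affine coordinate ring, pulled back to
   k[Y][X]: the closed points of the affine curve. *)
Record point_ideal (m : set R2) : Prop := PointIdeal {
  ideal_eqn : m f;
  idealD : forall g h, m g -> m h -> m (g + h);
  idealM : forall g h, m h -> m (g * h);
  ideal1 : ~ m 1;
  ideal_prime : forall g h, m (g * h) -> m g \/ m h;
  ideal_neq : exists2 g, m g & ~ exists h, g = h * f
}.

Definition sexticX : R2 := 6%:R * 'X ^+ 5 + 2%:R * c%:P%:P * 'X * 'Y ^+ 2.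
Definition sexticY : R2 := 6%:R * 'Y ^+ 5 + 2%:R * c%:P%:P * 'X ^+ 2 * 'Y.

Lemma deriv_sextic : f^`() = sexticX.
Proof.
have -> : f = 'X^6 + (c%:P * 'X^2)%:P * 'X^2 + ('X^6 + 1)%:P.
  by rewrite /U_eqn !(polyC_exp, polyCD, polyCM, polyC1); ring.
rewrite !derivD.
rewrite (derivC ('X^6 + 1 : {poly k})) addr0 deriv_mulC !derivXn polyCM polyC_exp /sexticX.
by rewrite expr1 -[_ *+ 6]mulr_natl -[_ *+ 2]mulr_natl; ring.
Qed.

Lemma swapXY_sexticX : swapXY sexticX = sexticY.
Proof.
rewrite /sexticX /sexticY !(rmorph_nat, rmorphXn, rmorphD, rmorphM) /=.
rewrite swapXY_X swapXY_Y (swapXY_polyC c%:P) map_polyC /=.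
by ring.
Qed.

Section Ideal.
Variables (m : set R2) (im : point_ideal m).

Lemma ideal0 : m 0.
Proof. by rewrite -(mul0r f); apply: (idealM im); apply: (ideal_eqn im). Qed.

Lemma idealB g h : m g -> m h -> m (g - h).
Proof. by move=> mg mh; rewrite -mulN1r; apply: (idealD im) => //; apply: (idealM im). Qed.

Lemma ideal_const (d : k) : d != 0 -> ~ m d%:P%:P.
Proof.
move=> d0 md; apply: (ideal1 im).
have -> : 1 = (d^-1)%:P%:P * d%:P%:P :> R2 by rewrite -!polyCM mulVf.
exact: (idealM im).
Qed.

(** The affine curve is smooth: modulo a common zero of the equation and of
   its partial derivatives, c x^2 y^2 = -3 and x^6 = y^6 = 1. *)
Lemma ideal_smooth : m sexticX -> m sexticY -> False.
Proof.
move=> mX mY.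
pose C : R2 := c%:P%:P; pose W : R2 := C * 'X ^+ 2 * 'Y ^+ 2.
have mW : m (6%:R + 2%:R * W).
  have -> : 6%:R + 2%:R * W = 6%:R * f + ((- 'X) * sexticX + (- 'Y) * sexticY).
    by rewrite /W /sexticX /sexticY /U_eqn -/C; ring.
  apply: (idealD im); first by apply: (idealM im); apply: (ideal_eqn im).
  by apply: (idealD im); apply: (idealM im).
have mX6 : m (6%:R * 'X ^+ 6 - 6%:R).
  have -> : 6%:R * 'X ^+ 6 - 6%:R = 'X * sexticX - (6%:R + 2%:R * W).
    by rewrite /W /sexticX -/C; ring.
  by apply: idealB => //; apply: (idealM im).
have mY6 : m (6%:R * 'Y ^+ 6 - 6%:R).
  have -> : 6%:R * 'Y ^+ 6 - 6%:R = 'Y * sexticY - (6%:R + 2%:R * W).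
    by rewrite /W /sexticY -/C; ring.
  by apply: idealB => //; apply: (idealM im).
(* 288 = 2^3 6^2 absorbs the coefficients of 2 W and of 6 X^6, 6 Y^6 in the
   elimination of W^3 = c^3 X^6 Y^6. *)
have d0 : 288%:R * (c ^+ 3 + 27%:R) != 0.
  rewrite mulf_neq0 // (_ : 288 = 2 ^ 3 * 6 ^ 2)%N // natrM !natrX.
  rewrite mulf_neq0 ?expf_neq0 //.
  by apply: contraNneq six0 => h; rewrite (natrM _ 2 3) h mul0r.
apply: (ideal_const d0).
have -> : (288%:R * (c ^+ 3 + 27%:R))%:P%:P =
    (36%:R * ((2%:R * W) ^+ 2 - 6%:R * (2%:R * W) + 36%:R)) * (6%:R + 2%:R * W)
    - 8%:R * C ^+ 3 * ((6%:R * 'Y ^+ 6) * (6%:R * 'X ^+ 6 - 6%:R)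
      + 6%:R * (6%:R * 'Y ^+ 6 - 6%:R)) :> R2.
  by rewrite /W -/C; ring.
apply: idealB; first exact: (idealM im).
by apply: (idealM im) => //; apply: (idealD im) => //; apply: (idealM im).
Qed.

Section Uniformizer.

(** P is a nonzero element of least degree in the intersection of m with k[Y],
   which is nonzero by elimination. *)
Lemma ideal_prime_below : exists P : {poly k},
  [/\ m P%:P, P != 0, forall D : {poly k}, m D%:P -> P %| D
    & forall D : {poly k}, ~ m D%:P -> exists a b, a * D + b * P = 1].
Proof.
have ex : exists n, `[< exists C : {poly k}, [/\ C != 0, m C%:P & size C = n] >].
  have [g mg ng] := ideal_neq im.
  have [u [v [C [C0 CE]]]] := sextic_elimination six0 c0 ng.
  exists (size C); apply/asboolP; exists C; split=> //.
  by rewrite CE; apply: (idealD im) => //; apply: (idealM im) => //; apply: (ideal_eqn im).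
case: (ex_minnP ex) => n /asboolP [P [P0 mP sP]] minP.
have PD (D : {poly k}) : m D%:P -> P %| D.
  move=> mD; apply/modp_eq0P/eqP; apply: contrapT => /negP D0.
  have : (n <= size (D %% P)%R)%N.
    apply: minP; apply/asboolP; exists (D %% P); split=> //.
    have -> : D %% P = D - D %/ P * P by rewrite {2}(divp_eq D P) addrAC subrr add0r.
    by rewrite polyCB polyCM; apply: idealB => //; apply: (idealM im).
  by rewrite -sP leqNgt ltn_modp P0.
have copr (D : {poly k}) : ~ m D%:P -> coprimep D P.
  move=> mD; set e := gcdp D P.
  have eP : e * (P %/ e) = P by rewrite mulrC divpK // dvdp_gcdr.
  have : m (e%:P * (P %/ e)%:P) by rewrite -polyCM eP.
  case/(ideal_prime im) => /PD.
    move=> Pe; case: mD; have /dvdpP [q ->] := dvdp_trans Pe (dvdp_gcdl D P).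
    by rewrite polyCM; apply: (idealM im).
  rewrite /coprimep -/e => h.
  have /dvdp_leq/(_ h) : P %/ e != 0.
    by apply: contraNneq P0 => e0; rewrite -eP e0 mulr0.
  have e0 : e != 0 by apply: contraNneq P0 => e0; rewrite -eP e0 mul0r.
  have e0' : P %/ e != 0 by apply: contraNneq P0 => e0'; rewrite -eP e0' mulr0.
  rewrite -{1}eP size_mul //.
  by move: e0 e0'; rewrite -!size_poly_gt0; move: (size _) (size _) => u v; lia.
exists P; split=> // D /copr /Bezout_eq1_coprimepP [[a b] /= ab].
by exists a, b.
Qed.

(** Take Q monic in X of least degree among such elements of m. Modulo P, the
   leading coefficients outside m are invertible, so P and Q generate m. Write
   f = Q R + P S. If R were in m, so would be f_X = Q_X R + Q R_X + P S_X.
   On the curve Q R = - P S, so R makes every element of m divisible by P. *)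
Lemma ideal_fibre : ~ m sexticX ->
  exists P : {poly k}, [/\ P != 0, m P%:P,
    forall D : {poly k}, m D%:P -> P %| D &
    exists2 R : R2, ~ m R &
      forall g, m g -> exists T q, g * R = P%:P * T + q * f].
Proof.
move=> mX; have [P [mP P0 PD PB]] := ideal_prime_below.
have ex : exists n, `[< exists Q : R2, [/\ Q \is monic, m Q & size Q = n] >].
  exists (size f); apply/asboolP; exists f; split=> //; last exact: (ideal_eqn im).
  exact: sextic_monic.
case: (ex_minnP ex) => n /asboolP [Q [Qm mQ sQ]] minQ.
have small N (r : R2) : (size r <= N)%N -> (size r < size Q)%N -> m r ->
    exists s, r = P%:P * s.
  elim: N r => [|N IH] r sN sr mr.
    by exists 0; rewrite mulr0; apply/eqP; rewrite -size_poly_eq0 -leqn0.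
  have [r0|r0] := eqVneq r 0; first by exists 0; rewrite mulr0.
  pose d := (size r).-1; pose l := r`_d; pose r1 := \poly_(i < d) r`_i.
  have sd : size r = d.+1 by rewrite prednK // size_poly_gt0.
  have rE : r = r1 + l%:P * 'X^d.
    apply/polyP => i; rewrite coefD coef_poly mul_polyC coefZ coefXn.
    case: ltngtP => [lt|lt|->]; rewrite ?mulr0 ?addr0 ?add0r ?mulr1 //.
    by rewrite nth_default // sd.
  have sr1 : (size r1 <= d)%N := size_poly _ _.
  have [ml|ml] := pselect (m l%:P).
    have /dvdpP [l' lE] := PD _ ml.
    have sN1 : (size r1 <= N)%N by rewrite (leq_trans sr1) // -ltnS -sd.
    have sQ1 : (size r1 < size Q)%N by rewrite (leq_ltn_trans sr1) // ltnW // -sd.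
    have [|s r1E] := IH r1 sN1 sQ1.
      have -> : r1 = r - 'X^d * l%:P by rewrite {1}rE mulrC addrK.
      by apply: idealB => //; apply: (idealM im).
    by exists (s + l'%:P * 'X^d); rewrite rE r1E lE polyCM; ring.
  have [a [b ab]] := PB _ ml.
  pose r2 := a%:P * r + (b%:P * 'X^d) * P%:P.
  have r2E : r2 = 'X^d + a%:P * r1.
    have : a%:P * l%:P + b%:P * P%:P = 1 :> R2 by rewrite -!polyCM -polyCD ab.
    by rewrite /r2 rE => E; rewrite -[in RHS](mul1r 'X^d) -E; ring.
  have sar : (size (a%:P * r1)%R < size ('X^d : R2)%R)%N.
    rewrite size_polyXn ltnS mul_polyC.
    exact: leq_trans (size_scale_leq _ _) sr1.
  have : (n <= size r2)%N.
    apply: minQ; apply/asboolP; exists r2; split=> //.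
      by rewrite r2E monicE lead_coefDl // lead_coefXn.
    by apply: (idealD im); apply: (idealM im).
  by rewrite r2E size_polyDl // size_polyXn -sd -sQ leqNgt sr.
have QP g : m g -> exists q s, g = q * Q + P%:P * s.
  move=> mg; have gE := Pdiv.RingMonic.rdivp_eq Qm g.
  have [||s rE] := small _ (Pdiv.CommonRing.rmodp g Q) (leqnn _).
  - by rewrite Pdiv.CommonRing.ltn_rmodp monic_neq0.
  - have -> : Pdiv.CommonRing.rmodp g Q = g - Pdiv.CommonRing.rdivp g Q * Q.
      by rewrite {2}gE addrAC subrr add0r.
    by apply: idealB => //; apply: (idealM im).
  by exists (Pdiv.CommonRing.rdivp g Q), s; rewrite -rE.
have [R [S fE]] := QP f (ideal_eqn im).
exists P; split=> //; exists R.
  move=> mR; apply: mX; rewrite -deriv_sextic fE derivD derivM (deriv_mulC P S).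
  apply: (idealD im); last by rewrite mulrC; apply: (idealM im).
  by apply: (idealD im); [apply: (idealM im) | rewrite mulrC; apply: (idealM im)].
move=> g /QP [q [s gE]]; exists (s * R - q * S), q.
by rewrite gE fE; ring.
Qed.
End Uniformizer.
End Ideal.
End PrimeIdeals.

(** * Local rings and places *)

Section LocalRings.
Local Open Scope classical_set_scope.
Local Open Scope ring_scope.
Variables (k : finFieldType) (K : fieldType) (iota : {rmorphism k -> K}) (c : k).
Hypotheses (six0 : 6%:R != 0 :> k) (c0 : c ^+ 3 + 27%:R != 0).
Local Notation f := (U_eqn c).
Local Notation R2 := {poly {poly k}}.

Lemma point_ideal_swap (m : set R2) :
  point_ideal c m -> point_ideal c [set g | m (swapXY g)].
Proof.
move=> im; split=> /=.
- by rewrite swapXY_sextic; apply: (ideal_eqn im).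
- by move=> g h mg mh; rewrite rmorphD; apply: (idealD im).
- by move=> g h mh; rewrite rmorphM; apply: (idealM im).
- by rewrite rmorph1; apply: (ideal1 im).
- by move=> g h; rewrite rmorphM; apply: (ideal_prime im).
have [g mg ng] := ideal_neq im; exists (swapXY g); first by rewrite swapXYK.
move=> [h hE]; apply: ng; exists (swapXY h).
by rewrite -[LHS]swapXYK hE rmorphM /= swapXY_sextic.
Qed.

Definition local_ring (x y : K) (m : set R2) : set K :=
  [set z | exists g h, ~ m h /\ z * eval2 iota x y h = eval2 iota x y g].

Definition uniformizes (x y : K) (m : set R2) (t : R2) : Prop :=
  eval2 iota x y t != 0 /\ forall a, eval2 iota x y a != 0 -> exists n g h, [/\ ~ m g, ~ m h &
    eval2 iota x y a * eval2 iota x y h = eval2 iota x y t ^+ n * eval2 iota x y g].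

Section Uniformizers.
Variables (x y : K) (xy : coordinates iota c x y) (m : set R2) (im : point_ideal c m).
Local Notation ev := (eval2 iota x y).

Lemma eval2_notin h : ~ m h -> ev h != 0.
Proof.
move=> mh; apply/eqP => /xy.1 [q hE]; apply: mh.
by rewrite hE; apply: (idealM im); apply: (ideal_eqn im).
Qed.

Lemma eval2_in g h : ev g = ev h -> m g -> m h.
Proof.
move=> /eqP; rewrite -subr_eq0 -eval2B => /eqP /xy.1 [q qE] mg.
have -> : h = g - q * f by rewrite -qE opprB addrC subrK.
by apply: (idealB im) => //; apply: (idealM im); apply: (ideal_eqn im).
Qed.

(** By elimination a divides C(Y) s modulo f for some C and some s not in m.
   When a is in m, P divides C, and a R = P T modulo f replaces a by T and C by
   C / P, whose degree is smaller; so the process stops. *)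
Lemma uniformizes_fibre : ~ m (sexticX c) -> exists t, uniformizes x y m t.
Proof.
move=> mX; have [P [P0 mP PD [R mR RP]]] := ideal_fibre six0 c0 im mX.
have evP : ev P%:P != 0.
  by apply/eqP => /xy.1; apply: polyC_not_multiple.
exists P%:P; split=> // a a0.
have [|u [v [C [C0 CE]]]] := @sextic_elimination k c six0 c0 a.
  by move=> /xy.1 a00; rewrite a00 eqxx in a0.
have {v CE} : ev u * ev a = ev (C%:P * 1).
  by rewrite mulr1 CE eval2D !eval2M /= (coordinates_eq xy) mulr0 addr0.
have {a0} : ~ m 1 := ideal1 im.
move: {2}(size C) (leqnn (size C)) => N.
elim: N a u C C0 (1 : R2) => [|N IH] a u C C0 s.
  by rewrite leqNgt size_poly_gt0 C0.
move=> sC ms E.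
have [ma|ma] := pselect (m a); last first.
  by exists 0, a, 1; rewrite rmorph1 expr0 mulr1 mul1r; split=> //; apply: (ideal1 im).
have mC : m C%:P.
  have : m (C%:P * s).
    by apply: (@eval2_in (u * a)); [rewrite eval2M | apply: (idealM im)].
  by move/(ideal_prime im); case.
have /dvdpP [C1 C1E] := PD _ mC.
have C10 : C1 != 0 by apply: contraNneq C0 => h; rewrite C1E h mul0r.
have [T [q aR]] := RP _ ma.
have aRE : ev a * ev R = ev P%:P * ev T.
  have := congr1 ev aR; rewrite eval2D !eval2M /= => ->.
  by rewrite (coordinates_eq xy) mulr0 addr0.
have sC1 : (size C1 <= N)%N.
  have P1 : (1 < size P)%N.
    rewrite ltnNge; apply/negP => /size1_polyC PE.
    apply: (ideal_const im (d := P`_0)); last by rewrite -PE.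
    by apply: contraNneq P0 => h; rewrite PE h.
  move: sC C10 P0 P1; rewrite C1E -!size_poly_gt0 => sC C10 P0 P1.
  rewrite size_mul -?size_poly_gt0 // in sC.
  by move: (size _) (size _) sC C10 P0 P1 => u' v'; lia.
have msR : ~ m (s * R) by move=> /(ideal_prime im) [].
have E1 : ev u * ev T = ev (C1%:P * (s * R)).
  apply: (mulfI evP); rewrite mulrCA -aRE mulrA E C1E polyCM !eval2M /=.
  by ring.
have [n [g [h [mg mh TE]]]] := IH T u C1 C10 (s * R) sC1 msR E1.
exists n.+1, g, (R * h); split=> //; first by move=> /(ideal_prime im) [].
by rewrite eval2M mulrA aRE -mulrA TE exprS mulrA.
Qed.
End Uniformizers.

Lemma uniformizes_exists x y m : coordinates iota c x y -> point_ideal c m ->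
  exists t, uniformizes x y m t.
Proof.
move=> xy im; have [mX|mX] := pselect (m (sexticX c)); last exact: uniformizes_fibre.
have mY : ~ [set g | m (swapXY g)] (sexticX c).
  by rewrite /= swapXY_sexticX => mY; apply: (ideal_smooth six0 c0 im).
have yx := coordinates_swap xy.
have [t [t0 tP]] := uniformizes_fibre yx (point_ideal_swap im) mY.
exists (swapXY t); split; rewrite eval2_swapXY // => a a0.
have [|n [g [h [mg mh E]]]] := tP (swapXY a); first by rewrite eval2_swapXY.
exists n, (swapXY g), (swapXY h); split=> //.
by move: E; rewrite eval2_swapXY => E; rewrite !(eval2_swapXY iota y x).
Qed.

Section Places.
Variables (x y : K) (xy : coordinates iota c x y).
Local Notation ev := (eval2 iota x y).

Lemma local_ring_eval m g : point_ideal c m -> local_ring x y m (ev g).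
Proof. by move=> im; exists g, 1; rewrite rmorph1 mulr1; split=> //; apply: (ideal1 im). Qed.

(** Numerator and denominator of any function are powers of the uniformizer
   times units; comparing the exponents tells whether z or 1/z is integral. *)
Lemma local_ring_valuation m : point_ideal c m ->
  valuation_ring iota (local_ring x y m).
Proof.
move=> im; have [t [t0 tP]] := uniformizes_exists xy im.
have prime g h : ~ m g -> ~ m h -> ~ m (g * h) by move=> mg mh /(ideal_prime im) [].
split.
- by move=> a; rewrite -(eval2CC iota x y); apply: local_ring_eval.
- move=> u v [g [h [mh E]]] [g' [h' [mh' E']]].
  exists (g * h' - g' * h), (h * h'); split; first exact: prime.
  by rewrite eval2B !eval2M -E -E'; ring.
- move=> u v [g [h [mh E]]] [g' [h' [mh' E']]].
  exists (g * g'), (h * h'); split; first exact: prime.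
  by rewrite !eval2M -E -E'; ring.
- move=> OT; have [g mg ng] := ideal_neq im.
  have g0 : ev g != 0 by apply/eqP => /xy.1.
  have [h [h' [mh' E]]] : local_ring x y m (ev g)^-1 by rewrite OT.
  apply: mh'; apply: (@eval2_in x y xy m im (h * g)); last exact: (idealM im).
  by rewrite eval2M -E mulrAC mulVf // mul1r.
move=> z; have [->|z0] := eqVneq z 0.
  by left; rewrite -(rmorph0 ev); apply: local_ring_eval.
have [a [b [b0 zE]]] := xy.2 z.
have a0 : ev a != 0 by apply: contraNneq z0 => h; rewrite zE h mul0r.
have [n [g [h [mg mh E]]]] := tP a a0; have [n' [g' [h' [mg' mh' E']]]] := tP b b0.
have nz q : ~ m q -> ev q != 0 := @eval2_notin x y xy m im q.
have [le|le] := leqP n' n; [left|right].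
  exists (t ^+ (n - n') * g * h'), (g' * h); split; first exact: prime.
  rewrite zE !eval2M rmorphXn /=.
  rewrite -(mulfK (nz _ mh) (ev a)) -(mulfK (nz _ mh') (ev b)) E E'.
  rewrite -{1}(subnK le) exprD; field.
  by rewrite expf_neq0 // !nz.
exists (t ^+ (n' - n) * g' * h), (g * h'); split; first exact: prime.
rewrite zE !eval2M rmorphXn /=.
rewrite -(mulfK (nz _ mh) (ev a)) -(mulfK (nz _ mh') (ev b)) E E'.
rewrite -{1}(subnK (ltnW le)) exprD; field.
by rewrite !expf_neq0 // !nz.
Qed.

Definition center (O : set K) : set R2 := [set g | maximal_ideal O (ev g)].

Section Place.
Variables (O : set K) (vO : valuation_ring iota O) (Ox : O x) (Oy : O y).

Lemma place_eval g : O (ev g).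
Proof.
apply: (eval2_closed (S := O)) => //.
- by move=> u v; apply: (valuation_ringD vO).
- exact: (valuation_ring_mul vO).
- exact: (valuation_ring_const vO).
Qed.

Lemma center_point_ideal : point_ideal c (center O).
Proof.
split.
- by rewrite /center /= (coordinates_eq xy); split; [apply: (valuation_ring0 vO) | left].
- by move=> g h; rewrite /center /= eval2D; apply: (maximal_idealD vO).
- move=> g h; rewrite /center /= eval2M; apply: (maximal_ideal_mul vO) => //.
  exact: place_eval.
- by rewrite /center /= rmorph1; apply: (maximal_idealN1 vO).
- move=> g h; rewrite /center /= eval2M; apply: (maximal_ideal_prime vO) => //;
    exact: place_eval.
apply: contrapT => small; apply: (valuation_ring_proper vO).
apply/seteqP; split=> // z _; have [g [h [h0 ->]]] := xy.2 z.
apply: (valuation_ring_mul vO); first exact: place_eval.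
have [] := unit_notin_maximal (place_eval h) => // mh.
by apply: small; exists h => // /xy.1 h00; rewrite h00 eqxx in h0.
Qed.

(** The local ring at the center of O is contained in O and is a valuation
   ring with the same center, so the inclusion is an equality. *)
Lemma place_local_ring : O = local_ring x y (center O).
Proof.
have im := center_point_ideal; have vL := local_ring_valuation im.
apply/seteqP; split=> z.
  move=> Oz; have [//|] := valuation_ring_total vL z.
  move=> [g [h [mh E]]]; have [z0|z0] := eqVneq z 0.
    by rewrite z0 -(rmorph0 ev); apply: local_ring_eval.
  have hE : ev h = z * ev g by rewrite -E mulrA divff ?mul1r.
  exists h, g; split=> // mg; apply: mh; rewrite /center /= hE.
  exact: (maximal_ideal_mul vO).
move=> [g [h [mh E]]].
have [h0 Oh] := unit_notin_maximal (place_eval h) mh.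
have -> : z = ev g * (ev h)^-1 by rewrite -E mulfK.
by apply: (valuation_ring_mul vO) => //; apply: place_eval.
Qed.

End Place.

(** The denominators of z form an ideal. If it were proper, it would lie in some
   maximal ideal m, and z would not belong to the valuation ring at m. *)
Lemma regular_functions z :
  (forall O, valuation_ring iota O -> O x -> O y -> O z) -> exists g, z = ev g.
Proof.
move=> Oz; pose I : set R2 := [set d | exists g, z * ev d = ev g].
have I0 : I 0 by exists 0; rewrite rmorph0 mulr0.
have ID g h : I g -> I h -> I (g + h).
  by move=> [a E] [b E']; exists (a + b); rewrite !eval2D -E -E' mulrDr.
have IM g h : I h -> I (g * h).
  by move=> [a E]; exists (g * a); rewrite !eval2M -E mulrCA.
have If : I f by exists 0; rewrite (coordinates_eq xy) rmorph0 mulr0.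
have [[g E]|I1] := pselect (I 1); first by exists g; rewrite -E rmorph1 mulr1.
exfalso.
pose proper (A : set R2) := [/\ I `<=` A, forall g h, A g -> A h -> A (g + h),
  forall g h, A h -> A (g * h) & ~ A 1].
(* The empty set serves as the upper bound of the empty chain. *)
have [m [pm maxm]] : exists m, proper m /\ forall B, m `<` B -> ~ proper B.
  have [F FP tot|m [Am Bm]] := @Zorn_bigcup _ [set A | proper A \/ A = set0].
    have [[A FA pA]|none] := pselect (exists2 A, F A & proper A); last first.
      right; apply/seteqP; split=> [g [A FA Ag]|g []].
      case: (FP A FA) => [pA|A0]; last by move: Ag; rewrite A0.
      by case: none; exists A.
    have pr B g : F B -> B g -> proper B.
      by move=> FB Bg; case: (FP B FB) => [//|B0]; move: Bg; rewrite B0.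
    left; case: (pA) => IA _ _ _; split.
    - by move=> g Ig; exists A; [exact: FA | exact: IA].
    - move=> g h [B FB Bg] [C FC Ch]; case: (tot B C FB FC) => [BC|CB].
        have [_ CD _ _] := pr C h FC Ch.
        by exists C; [exact: FC | exact: (CD _ _ (BC _ Bg) Ch)].
      have [_ BD _ _] := pr B g FB Bg.
      by exists B; [exact: FB | exact: (BD _ _ Bg (CB _ Ch))].
    - move=> g h [B FB Bh]; have [_ _ BM _] := pr B h FB Bh.
      by exists B; [exact: FB | exact: BM].
    - by move=> [B FB B1]; have [_ _ _] := pr B 1 FB B1; apply.
  case: Am => [pm|m0].
    by exists m; split; [exact: pm | move=> B mB pB; apply: (Bm B mB); left].
  exists I; split; first by split; [move=> g | exact: ID | exact: IM | exact: I1].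
  move=> B IB pB; apply: (Bm B); last by left.
  case: pB => IB' _ _ _; rewrite m0; split=> [g []|BI].
  exact: (BI 0 (IB' 0 I0)).
case: pm => Im mD mM m1.
have im : point_ideal c m.
  split; [exact: Im | exact: mD | exact: mM | exact: m1 | |].
    move=> g h mgh; apply: contrapT => /not_orP [mg mh].
    pose B : set R2 := [set b | exists a q, m a /\ b = a + q * g].
    have mB : m `<` B.
      split=> [a ma|BI].
        by exists a, 0; split; [exact: ma | rewrite mul0r addr0].
      apply: mg; apply: BI; exists 0, 1.
      by split; [exact: (Im 0 I0) | rewrite mul1r add0r].
    apply: (maxm B mB); split.
    - by move=> a /Im ma; apply: mB.1.
    - move=> _ _ [a [q [ma ->]]] [a' [q' [ma' ->]]].
      by exists (a + a'), (q + q'); split; [exact: mD | ring].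
    - move=> b _ [a [q [ma ->]]].
      by exists (b * a), (b * q); split; [exact: mM | ring].
    - move=> [a [q [ma E]]]; apply: mh.
      have -> : h = h * a + q * (g * h) by rewrite -[LHS]mulr1 E; ring.
      by apply: mD; apply: mM.
  have [g [h [h0 zE]]] := xy.2 z; exists h.
    by apply: Im; exists g; rewrite zE divfK.
  by move=> /xy.1 h00; rewrite h00 eqxx in h0.
have [|||g [h [mh E]]] := Oz (local_ring x y m).
- exact: local_ring_valuation.
- by have := local_ring_eval 'X im; rewrite eval2X.
- by have := local_ring_eval 'Y im; rewrite eval2Y.
by apply: mh; apply: Im; exists g.
Qed.

End Places.

(** If 1/x were in the maximal ideal, dividing the equation by x^6 would
   express 1 as an element of it. *)
Lemma integral_coordinate x y (O : set K) : coordinates iota c x y ->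
  valuation_ring iota O -> O y -> O x.
Proof.
move=> xy vO Oy; apply: contrapT => Ox.
have x0 : x != 0 by apply: coordinate_y_neq0 (coordinates_swap xy).
have mx : maximal_ideal O x^-1.
  by split; [case: (valuation_ring_total vO x) | right; rewrite invrK].
apply: (maximal_idealN1 vO).
have := coordinates_eq xy; rewrite eval2_sextic => E.
have -> : 1 = - (x^-1 ^+ 5 * (y ^+ 6 + 1) + iota c * y ^+ 2 * x^-1 ^+ 3) * x^-1.
  apply/eqP; rewrite -subr_eq0; apply/eqP.
  transitivity (x^-1 ^+ 6 * (x ^+ 6 + y ^+ 6 + 1 + iota c * x ^+ 2 * y ^+ 2)).
    by field.
  by rewrite E mulr0.
have Ox' := mx.1.
apply: (maximal_ideal_mul vO) => //; apply: (valuation_ringN vO).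
apply: (valuation_ringD vO); apply: (valuation_ring_mul vO).
- exact: (valuation_ringX vO).
- by apply: (valuation_ringD vO); [apply: (valuation_ringX vO) | apply: (valuation_ring1 vO)].
- apply: (valuation_ring_mul vO); last exact: (valuation_ringX vO).
  exact: (valuation_ring_const vO).
- exact: (valuation_ringX vO).
Qed.

(** If y is integral, so is x. Otherwise 1/y is integral, and so is x/y by the
   same argument in the chart (x/y, 1/y): the remaining point of the projective
   plane, where 1/x and y/x vanish, is not on the curve. *)
Lemma place_center x y (O : set K) : coordinates iota c x y ->
  valuation_ring iota O -> (O x /\ O y) \/ (O (x / y) /\ maximal_ideal O y^-1).
Proof.
move=> xy vO; have [Oy|Oy] := pselect (O y).
  by left; split=> //; apply: integral_coordinate xy vO Oy.
right; have Oy' : O y^-1 by case: (valuation_ring_total vO y).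
have mn := integral_coordinate (coordinates_infinity six0 c0 xy) vO Oy'.
by split=> //; split=> //; right; rewrite invrK.
Qed.
End LocalRings.

(** * Derivations of the function field *)

Section Derivations.
Variables (k : finFieldType) (K : fieldType) (iota : {rmorphism k -> K}).
Implicit Types D : derivation iota.

Lemma der0 D : D 0 = 0.
Proof. by have := der_const D 0; rewrite rmorph0. Qed.

Lemma der1 D : D 1 = 0.
Proof. by have := der_const D 1; rewrite rmorph1. Qed.

Lemma derXn D u n : D (u ^+ n.+1) = n.+1%:R * u ^+ n * D u.
Proof.
elim: n => [|n IH]; first by rewrite expr1 expr0 !mul1r.
by rewrite exprS derM IH -[n.+2%:R]natr1 exprS; ring.
Qed.

Lemma der_div D u v : v != 0 -> D (u / v) = (D u - u / v * D v) / v.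
Proof.
move=> v0; apply: (mulfI v0); rewrite mulrC [RHS]mulrC divfK //.
have := derM D (u / v) v; rewrite divfK // => ->.
by ring.
Qed.

Lemma der_inv D v : v != 0 -> D v^-1 = - v^-1 ^+ 2 * D v.
Proof.
move=> v0; have := der_div D 1 v0; rewrite !mul1r der1 => ->.
by rewrite sub0r mulNr mulrC mulrA mulNr expr2.
Qed.

Fact scale_derD a D u v : a * D (u + v) = a * D u + a * D v.
Proof. by rewrite derD mulrDr. Qed.

Fact scale_derM a D u v : a * D (u * v) = u * (a * D v) + v * (a * D u).
Proof. by rewrite derM; ring. Qed.

Fact scale_der_const a D c : a * D (iota c) = 0.
Proof. by rewrite der_const mulr0. Qed.

Definition scale_derivation a D : derivation iota :=
  Derivation (scale_derD a D) (scale_derM a D) (scale_der_const a D).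

Definition proportional a D1 D2 : Prop := forall z, D1 z = a * D2 z.

(** The derivations form a line over K, so a homogeneous function of
   derivations is determined by one value; differentials are such functions. *)
Definition homogeneous (w : derivation iota -> K) : Prop :=
  forall a D1 D2, proportional a D1 D2 -> w D1 = a * w D2.

Lemma differential_homogeneous s : homogeneous (@differential k K iota s).
Proof.
move=> a D1 D2 prop; rewrite /differential mulr_sumr; apply: eq_bigr => ab _.
by rewrite prop mulrCA.
Qed.

Variables (c : k).
Hypotheses (six0 : 6%:R != 0 :> k) (c0 : c ^+ 3 + 27%:R != 0).
Local Notation f := (U_eqn c).
Local Notation R2 := {poly {poly k}}.

Lemma eval2_sexticX x y : eval2 iota x y (sexticX c) = 6%:R * x ^+ 5 + 2%:R * iota c * x * y ^+ 2.
Proof.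
rewrite /sexticX !(eval2_nat, eval2_exp, eval2D, eval2M).
by rewrite eval2X eval2Y eval2CC.
Qed.

Lemma eval2_sexticY x y : eval2 iota x y (sexticY c) = 6%:R * y ^+ 5 + 2%:R * iota c * x ^+ 2 * y.
Proof.
rewrite /sexticY !(eval2_nat, eval2_exp, eval2D, eval2M).
by rewrite eval2X eval2Y eval2CC.
Qed.

Section Fixed.
Variables (x y : K) (xy : coordinates iota c x y).
Local Notation ev := (eval2 iota x y).

Lemma proportionalP a D1 D2 :
  D1 x = a * D2 x -> D1 y = a * D2 y -> proportional a D1 D2.
Proof.
move=> Ex Ey.
have pol g : D1 (ev g) = a * D2 (ev g).
  apply: (@eval2_closed k K iota x y (fun z => D1 z = a * D2 z)) => //.
  - by move=> u v Eu Ev; rewrite !derD Eu Ev mulrDr.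
  - by move=> u v Eu Ev; rewrite !derM Eu Ev; ring.
  - by move=> d; rewrite !der_const mulr0.
move=> z; have [g [h [h0 ->]]] := xy.2 z.
by rewrite !der_div // !pol; ring.
Qed.

Lemma der_sextic D : ev (sexticX c) * D x + ev (sexticY c) * D y = 0.
Proof.
have := congr1 D (coordinates_eq xy); rewrite eval2_sextic !derD der1 der0.
rewrite !(derXn, derM, der_const) eval2_sexticX eval2_sexticY => <-.
by ring.
Qed.

Lemma eval2_sexticY_neq0 : ev (sexticY c) != 0.
Proof.
apply/eqP => /xy.1 [h E].
have sY : (size (sexticY c) <= 3)%N.
  have -> : sexticY c = (6%:R * 'X ^+ 5)%:P + (2%:R * c%:P * 'X)%:P * 'X ^+ 2.
    by rewrite /sexticY; ring.
  apply: (leq_trans (size_polyD _ _)); rewrite geq_max.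
  rewrite (leq_trans (size_polyC_leq1 _)) // mul_polyC.
  by rewrite (leq_trans (size_scale_leq _ _)) // size_polyXn.
have h0 : h = 0.
  apply: contraTeq sY => h0; rewrite E size_Mmonic ?sextic_monic // size_sextic.
  by move: h0; rewrite -size_poly_gt0; move: (size _) => n; lia.
have : (sexticY c)`_0`_5 = 6%:R.
  have -> : sexticY c = (6%:R * 'X ^+ 5)%:P + (2%:R * c%:P * 'X)%:P * 'X ^+ 2.
    by rewrite /sexticY; ring.
  rewrite coefD coefC coefCM coefXn mulr0 addr0 /= -polyC_natr mul_polyC coefZ.
  by rewrite coefXn mulr1.
by rewrite E h0 mul0r !coef0 => /esym/eqP; rewrite (negPf six0).
Qed.

End Fixed.
End Derivations.

(** * The jacobian derivation *)

Section JacobianDerivation.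
Variables (k : finFieldType) (K : fieldType) (iota : {rmorphism k -> K}).
Variables (c : k).
Hypotheses (six0 : 6%:R != 0 :> k) (c0 : c ^+ 3 + 27%:R != 0).
Local Notation f := (U_eqn c).
Local Notation R2 := {poly {poly k}}.

(** The derivation of k[X, Y] on which dX / f_Y = - dY / f_X takes the value 1. *)
Definition jacobian_der (g : R2) : R2 :=
  sexticY c * g^`() - sexticX c * swapXY (swapXY g)^`().

Lemma jacobian_derD g h : jacobian_der (g + h) = jacobian_der g + jacobian_der h.
Proof. by rewrite /jacobian_der !(derivD, rmorphD) /=; ring. Qed.

Lemma jacobian_derM g h :
  jacobian_der (g * h) = g * jacobian_der h + h * jacobian_der g.
Proof.
rewrite /jacobian_der (rmorphM (@swapXY k)) !derivM rmorphD !rmorphM /=.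
by rewrite !swapXYK; ring.
Qed.

Lemma jacobian_derC (a : k) : jacobian_der a%:P%:P = 0.
Proof.
rewrite /jacobian_der (swapXY_polyC a%:P) map_polyC /= !(derivC a%:P).
by rewrite rmorph0 !mulr0 subr0.
Qed.

Lemma jacobian_der_sextic : jacobian_der f = 0.
Proof.
by rewrite /jacobian_der swapXY_sextic deriv_sextic swapXY_sexticX mulrC subrr.
Qed.

Lemma jacobian_derX : jacobian_der 'X = sexticY c.
Proof.
rewrite /jacobian_der swapXY_X (derivC ('X : {poly k})) derivX rmorph0.
by rewrite mulr1 mulr0 subr0.
Qed.

Lemma jacobian_derY : jacobian_der 'Y = - sexticX c.
Proof.
rewrite /jacobian_der swapXY_Y (derivC ('X : {poly k})) derivX rmorph1.
by rewrite mulr1 mulr0 sub0r.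
Qed.

Lemma jacobian_derB g h : jacobian_der (g - h) = jacobian_der g - jacobian_der h.
Proof.
have := jacobian_derD (g - h) h; rewrite subrK => ->.
by rewrite addrK.
Qed.

(* Evaluation lemmas for sums would otherwise see through this definition. *)
Local Opaque jacobian_der.

Section Fixed.
Variables (x y : K) (xy : coordinates iota c x y).
Local Notation ev := (eval2 iota x y).

Lemma eval2_jacobian_der0 g : ev g = 0 -> ev (jacobian_der g) = 0.
Proof.
move=> /xy.1 [h ->]; rewrite jacobian_derM jacobian_der_sextic mulr0 add0r.
by rewrite eval2M (coordinates_eq xy) mul0r.
Qed.

Let num z : R2 := sval (cid (xy.2 z)).
Let den z : R2 := sval (cid (svalP (cid (xy.2 z)))).

Let den0 z : ev (den z) != 0.
Proof. by have [] := svalP (cid (svalP (cid (xy.2 z)))). Qed.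

Let numE z : z * ev (den z) = ev (num z).
Proof.
have [d0 E] := svalP (cid (svalP (cid (xy.2 z)))).
by rewrite [X in X * _]E divfK.
Qed.

Let der z := (ev (jacobian_der (num z)) - z * ev (jacobian_der (den z))) / ev (den z).

Let derE z g h : ev h != 0 -> z * ev h = ev g ->
  der z * ev h = ev (jacobian_der g) - z * ev (jacobian_der h).
Proof.
move=> h0 E; have d0 := den0 z; have nE := numE z.
have F : ev (jacobian_der (g * den z - num z * h)) = 0.
  by apply: eval2_jacobian_der0; rewrite eval2B !eval2M -E -nE; ring.
rewrite jacobian_derB !jacobian_derM eval2B !eval2D !eval2M -E -nE in F.
apply: (mulIf d0); rewrite mulrAC /der divfK //.
apply: subr0_eq; rewrite -[RHS]oppr0 -[in RHS]F; ring.
Qed.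

Let derD' u v : der (u + v) = der u + der v.
Proof.
have du := den0 u; have dv := den0 v.
have d0 : ev (den u * den v) != 0 by rewrite eval2M mulf_neq0.
apply: (mulIf d0); rewrite (derE d0 (g := num u * den v + num v * den u)).
  rewrite mulrDl jacobian_derD !jacobian_derM !eval2D !eval2M.
  have Du := derE du (numE u); have Dv := derE dv (numE v).
  transitivity (der u * ev (den u) * ev (den v) + der v * ev (den v) * ev (den u));
    last by ring.
  by rewrite Du Dv -!numE; ring.
by rewrite eval2D !eval2M -!numE; ring.
Qed.

Let derM' u v : der (u * v) = u * der v + v * der u.
Proof.
have du := den0 u; have dv := den0 v.
have d0 : ev (den u * den v) != 0 by rewrite eval2M mulf_neq0.
apply: (mulIf d0); rewrite (derE d0 (g := num u * num v)).
  rewrite mulrDl !jacobian_derM !eval2D !eval2M.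
  have Du := derE du (numE u); have Dv := derE dv (numE v).
  transitivity (u * (der v * ev (den v)) * ev (den u)
     + v * (der u * ev (den u)) * ev (den v)); last by ring.
  by rewrite Du Dv -!numE; ring.
by rewrite !eval2M -!numE; ring.
Qed.

Let one0 : ev 1 != 0.
Proof. by rewrite (eval2_nat iota x y 1) oner_eq0. Qed.

Let derR g : der (ev g) = ev (jacobian_der g).
Proof.
have E : ev g * ev 1 = ev g by rewrite (eval2_nat iota x y 1) mulr1.
have := derE one0 E.
by rewrite (eval2_nat iota x y 1) mulr1 (jacobian_derC 1) (eval2_nat iota x y 0) mulr0 subr0.
Qed.

Let der_const' a : der (iota a) = 0.
Proof.
by rewrite -(eval2CC iota x y) derR jacobian_derC (eval2_nat iota x y 0).
Qed.

(** The quotient rule gives the same value on all fractions representing z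
   because the derivation of k[X, Y] sends multiples of f to multiples of f. *)
Lemma jacobian_derivation_exists : exists D : derivation iota,
  D x = ev (sexticY c) /\ D y = - ev (sexticX c).
Proof.
exists (Derivation derD' derM' der_const') => /=.
have := derR 'X; have := derR 'Y; rewrite eval2X eval2Y jacobian_derX jacobian_derY.
by rewrite -sub0r eval2B (eval2_nat iota x y 0) sub0r.
Qed.

End Fixed.
End JacobianDerivation.

(** * Regularity of differentials in the two charts *)

Section Regularity.
Local Open Scope classical_set_scope.
Local Open Scope ring_scope.
Variables (k : finFieldType) (K : fieldType) (iota : {rmorphism k -> K}).
Variables (c : k).
Hypotheses (six0 : 6%:R != 0 :> k) (c0 : c ^+ 3 + 27%:R != 0).
Local Notation f := (U_eqn c).
Local Notation R2 := {poly {poly k}}.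
Implicit Types D : derivation iota.

Definition jacobian_derivation (x y : K) D : Prop :=
  D x = eval2 iota x y (sexticY c) /\ D y = - eval2 iota x y (sexticX c).

Section Chart.
Variables (x y : K) (xy : coordinates iota c x y) (D : derivation iota).
Hypothesis DJ : jacobian_derivation x y D.
Variables (O : set K) (vO : valuation_ring iota O) (Ox : O x) (Oy : O y).
Local Notation ev := (eval2 iota x y).

(** Elements of the valuation ring are fractions with denominator outside its
   center, and the derivation preserves the coordinate ring. *)
Lemma der_place z : O z -> O (D z).
Proof.
have pol g : O (D (ev g)).
  suff [] : O (ev g) /\ O (D (ev g)) by [].
  apply: (@eval2_closed k K iota x y (fun z => O z /\ O (D z))).
  - move=> u v [Ou ODu] [Ov ODv]; rewrite derD.
    by split; apply: (valuation_ringD vO).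
  - move=> u v [Ou ODu] [Ov ODv]; rewrite derM; split.
      exact: (valuation_ring_mul vO).
    by apply: (valuation_ringD vO); apply: (valuation_ring_mul vO).
  - move=> a; rewrite der_const.
    by split; [apply: (valuation_ring_const vO) | apply: (valuation_ring0 vO)].
  - by rewrite DJ.1; split=> //; apply: (place_eval vO Ox Oy).
  - rewrite DJ.2; split=> //; apply: (valuation_ringN vO).
    exact: (place_eval vO Ox Oy).
rewrite {1}(place_local_ring six0 c0 xy vO Ox Oy) => -[g [h [mh E]]].
have [h0 Oh] := unit_notin_maximal (place_eval vO Ox Oy h) mh.
have zE : z = ev g / ev h by rewrite -E mulfK.
have Oz : O z by rewrite zE; apply: (valuation_ring_mul vO) => //; apply: (place_eval vO Ox Oy).
rewrite [X in D X]zE der_div // -zE.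
apply: (valuation_ring_mul vO) => //; apply: (valuation_ring_sub vO) => //.
exact: (valuation_ring_mul vO).
Qed.

(** By smoothness f_X and f_Y do not both vanish at the center, so the derivative
   of y or that of x is a unit. *)
Lemma local_parameter : exists2 t, O t & D t != 0 /\ O (D t)^-1.
Proof.
have im := center_point_ideal xy vO Ox Oy.
have [mY|mY] := pselect (center iota x y O (sexticY c)); last first.
  by exists x => //; rewrite DJ.1; apply: unit_notin_maximal => //; apply: (place_eval vO Ox Oy).
have mX : ~ center iota x y O (sexticX c) by move=> mX; apply: (ideal_smooth six0 c0 im).
exists y => //; rewrite DJ.2 oppr_eq0 invrN.
have [d0 Od] := unit_notin_maximal (place_eval vO Ox Oy _) mX.
by split=> //; apply: (valuation_ringN vO).
Qed.

(** Differentiating the equation gives f_X D'x + f_Y D'y = 0. *)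
Lemma jacobian_proportional D' : exists a, proportional a D' D.
Proof.
have dY0 := eval2_sexticY_neq0 six0 c0 xy.
exists (D' x / ev (sexticY c)); apply: (proportionalP xy).
  by rewrite DJ.1 divfK.
apply: (mulfI dY0); have := der_sextic xy D'; rewrite DJ.2.
move=> /eqP; rewrite addrC addr_eq0 => /eqP ->.
by field.
Qed.

(** The derivation D maps the valuation ring to itself, so sums of a db take
   integral values at D. Conversely w = (w D / D t) dt for a local parameter t,
   whose derivative D t is a unit. *)
Lemma regular_atP w : homogeneous w -> regular_at O w <-> O (w D).
Proof.
move=> hw; split=> [[s Os ->]|Ow].
  rewrite /differential; elim: s Os => [|ab s IH] Os.
    by rewrite big_nil; apply: (valuation_ring0 vO).
  rewrite big_cons; have [Oa Ob] := Os ab (mem_head _ _).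
  apply: (valuation_ringD vO).
    by apply: (valuation_ring_mul vO) => //; apply: der_place.
  by apply: IH => cd cds; apply: Os; rewrite inE cds orbT.
have [t Ot [t0 Odt]] := local_parameter.
exists [:: (w D / D t, t)] => [ab|].
  by rewrite inE => /eqP -> /=; split=> //; apply: (valuation_ring_mul vO).
apply/funext => D'; have [a pa] := jacobian_proportional D'.
by rewrite /differential big_seq1 /= pa (hw _ _ _ pa) mulrCA divfK.
Qed.

End Chart.

(** Dividing by y^6 turns the equation in x and y into the one in x/y and 1/y;
   the factor is a cube because the canonical sheaf of a plane sextic is O(3). *)
Lemma jacobian_infinity x y D : coordinates iota c x y -> jacobian_derivation x y D ->
  jacobian_derivation (x / y) y^-1 (scale_derivation (- y^-1 ^+ 3) D).
Proof.
move=> xy [Dx Dy]; have y0 := coordinate_y_neq0 six0 c0 xy.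
have := coordinates_eq xy; rewrite eval2_sextic => E.
rewrite /jacobian_derivation /= der_div // der_inv // Dx Dy.
rewrite !eval2_sexticX !eval2_sexticY; split; last by field.
apply: subr0_eq.
transitivity (- 6%:R * y^-1 ^+ 5 *
  (x ^+ 6 + y ^+ 6 + 1 + iota c * x ^+ 2 * y ^+ 2)); first by field.
by rewrite E mulr0.
Qed.

Section AffineDegree.
Variables (x y : K) (xy : coordinates iota c x y).
Local Notation ev := (eval2 iota x y).

(** Put w = x/y and s = 1/y, so that 1, w, .., w^5 form a basis over k(s). The
   coefficient of w^i is s^(3 - i) G_i(1/s) by the first expression and E_i(s)
   by the second one; the former is a polynomial in s only if the degree of G_i
   is at most 3 - i. *)
Lemma pole_order_degree (G E : R2) : (size G <= 6)%N -> (size E <= 6)%N ->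
  ev G * y^-1 ^+ 3 = eval2 iota (x / y) y^-1 E ->
  forall i j, (3 < i + j)%N -> G`_i`_j = 0.
Proof.
move=> sG sE GE i j ij; have y0 := coordinate_y_neq0 six0 c0 xy.
have ws := coordinates_infinity six0 c0 xy.
have [i6|i6] := leqP 6 i; first by rewrite (nth_default _ (leq_trans sG i6)) coef0.
pose N := (sizeY G + j)%N.
have sGN l : (size (G`_l)%R <= N.+1)%N.
  by rewrite (leq_trans (max_size_coefXY _ _)) // /N -addnS leq_addr.
(* Reversal of the coefficients turns C(T) into T^N C(1/T). *)
pose rv (C : {poly k}) : {poly k} := \poly_(l < N.+1) C`_(N - l).
have rvE (C : {poly k}) : (size C <= N.+1)%N ->
    (map_poly iota (rv C)).[y^-1] = y^-1 ^+ N * (map_poly iota C).[y].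
  move=> sC; rewrite (@horner_coef_wide _ N.+1); last by rewrite size_map_poly size_poly.
  rewrite (@horner_coef_wide _ N.+1 (map_poly iota C)); last by rewrite size_map_poly.
  rewrite mulr_sumr [RHS](reindex_inj rev_ord_inj) /=; apply: eq_bigr => l _.
  rewrite !coef_map coef_poly ltn_ord /= subSS mulrCA; congr (_ * _).
  have lN : (l <= N)%N by rewrite -ltnS ltn_ord.
  by rewrite -{2}(subnK lN) exprD exprVn mulrAC mulVf ?mul1r // expf_neq0.
pose F : R2 := \poly_(l < 6) ('X^(8 - l) * rv G`_l - 'X^(N + 5) * E`_l).
have evsum (A B : K) (H : R2) : (size H <= 6)%N ->
    eval2 iota A B H = \sum_(l < 6) (map_poly iota H`_l).[B] * A ^+ l.
  move=> sH; rewrite /eval2 /base_change.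
  have sH' : (size (map_poly (map_poly iota) H) <= 6)%N.
    rewrite size_map_inj_poly ?rmorph0 //.
    by apply: map_inj_poly; [exact: fmorph_inj | rewrite rmorph0].
  rewrite (horner_coef_wide _ sH').
  rewrite horner_sum; apply: eq_bigr => l _.
  by rewrite hornerM -polyC_exp hornerC coef_map.
have F0 : F = 0.
  suff : eval2 iota (x / y) y^-1 F = 0.
    move/ws.1 => [h FE]; have [h0|h0] := eqVneq h 0; first by rewrite FE h0 mul0r.
    have : (size F <= 6)%N := size_poly _ _.
    rewrite FE size_Mmonic ?sextic_monic // size_sextic.
    by move: h0; rewrite -size_poly_gt0; move: (size _) => n; lia.
  rewrite evsum ?size_poly //.
  transitivity (\sum_(l < 6) (y^-1 ^+ (N + 5) * (y^-1 ^+ 3 * ((map_poly iota G`_l).[y] * x ^+ l))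
     - y^-1 ^+ (N + 5) * ((map_poly iota E`_l).[y^-1] * (x / y) ^+ l))).
    apply: eq_bigr => l _.
    rewrite coef_poly ltn_ord rmorphB !rmorphM /= !map_polyXn hornerD hornerN !hornerM.
    rewrite !hornerXn rvE // mulrBl; congr (_ - _); last by rewrite mulrA.
    have -> : y^-1 ^+ (N + 5) * (y^-1 ^+ 3 * ((map_poly iota G`_l).[y] * x ^+ l)) =
      y^-1 ^+ 8 * (y^-1 ^+ N * (map_poly iota G`_l).[y] * x ^+ l) by rewrite exprD; ring.
    have l8 : (l <= 8)%N by rewrite (leq_trans (ltnW (ltn_ord l))).
    by rewrite -{2}(subnK l8) exprD exprMn; ring.
  by rewrite sumrB -!mulr_sumr -!evsum // -GE; ring.
have := congr1 (fun H : R2 => H`_i`_(8 - i + (N - j))) F0.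
rewrite coef_poly i6 !coef0 coefB coefXnM coefXnM.
have jN : (j <= N)%N by rewrite /N leq_addl.
have -> : (8 - i + (N - j) < 8 - i)%N = false by lia.
have -> : (8 - i + (N - j) < N + 5)%N by lia.
rewrite subr0 addKn coef_poly; have -> : (N - j < N.+1)%N by lia.
by rewrite subKn.
Qed.

End AffineDegree.
End Regularity.

(** * The genus *)

Definition cubic_monomials : seq (nat * nat) :=
  [:: (0, 0); (0, 1); (0, 2); (0, 3); (1, 0); (1, 1); (1, 2); (2, 0); (2, 1); (3, 0)]%N.

Definition cubic_monomial (i : 'I_10) : nat * nat := nth (0, 0)%N cubic_monomials i.

Lemma cubic_monomial_inj : injective cubic_monomial.
Proof.
move=> i j /eqP; rewrite nth_uniq //; [by move/eqP/val_inj | exact: ltn_ord..].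
Qed.

Lemma cubic_monomialP p q : (p + q <= 3)%N -> exists i, cubic_monomial i = (p, q).
Proof.
move=> pq; have : (p, q) \in cubic_monomials.
  by move: p q pq => [|[|[|[|p]]]] [|[|[|[|q]]]].
move=> h; have lt : (index (p, q) cubic_monomials < 10)%N by rewrite index_mem.
by exists (Ordinal lt); rewrite /cubic_monomial nth_index.
Qed.

Lemma cubic_monomial_degree i : ((cubic_monomial i).1 + (cubic_monomial i).2 <= 3)%N.
Proof.
have : all (fun m : nat * nat => m.1 + m.2 <= 3)%N cubic_monomials by [].
by move/allP; apply; apply: mem_nth.
Qed.

Section Genus.
Local Open Scope classical_set_scope.
Local Open Scope ring_scope.
Variables (k : finFieldType) (K : fieldType) (iota : {rmorphism k -> K}).
Variables (c : k).
Hypotheses (six0 : 6%:R != 0 :> k) (c0 : c ^+ 3 + 27%:R != 0).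
Local Notation f := (U_eqn c).
Local Notation R2 := {poly {poly k}}.

(** The polynomials of degree at most 3, in the form of their coordinates. *)
Definition cubic_poly (a : {ffun 'I_10 -> k}) : R2 :=
  \sum_i ((a i)%:P * 'X ^+ (cubic_monomial i).2)%:P * 'X ^+ (cubic_monomial i).1.

Lemma coef_cubic_poly a p q :
  (cubic_poly a)`_p`_q = \sum_i a i * (cubic_monomial i == (p, q))%:R.
Proof.
rewrite /cubic_poly !coef_sum; apply: eq_bigr => i _.
rewrite coefCM coefXn; case: (cubic_monomial i) => u v /=.
rewrite xpair_eqE eq_sym; case: eqP => _ /=; last by rewrite mulr0 coef0 mulr0.
by rewrite mulr1 coefCM coefXn eq_sym.
Qed.

Lemma coef_cubic_monomial a i :
  (cubic_poly a)`_((cubic_monomial i).1)`_((cubic_monomial i).2) = a i.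
Proof.
rewrite coef_cubic_poly (bigD1 i) //= -surjective_pairing eqxx mulr1.
rewrite big1 ?addr0 // => j ji.
by rewrite (inj_eq cubic_monomial_inj) (negPf ji) mulr0.
Qed.

Lemma cubic_polyP (G : R2) : (forall p q, (3 < p + q)%N -> G`_p`_q = 0) ->
  G = cubic_poly [ffun i => G`_((cubic_monomial i).1)`_((cubic_monomial i).2)].
Proof.
move=> G0; apply/polyP => p; apply/polyP => q.
have [pq|pq] := leqP (p + q) 3.
  have [i iE] := cubic_monomialP pq.
  have := coef_cubic_monomial [ffun i => G`_((cubic_monomial i).1)`_((cubic_monomial i).2)] i.
  by rewrite ffunE iE /= => ->.
rewrite G0 // coef_cubic_poly big1 // => i _.
case: eqP => [E|_]; last by rewrite mulr0.
by have := cubic_monomial_degree i; rewrite E leqNgt pq.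
Qed.

Lemma size_cubic_poly a : (size (cubic_poly a) <= 6)%N.
Proof.
apply/leq_sizeP => p p6; apply/polyP => q; rewrite coef0 coef_cubic_poly big1 // => i _.
case: eqP => [E|_]; last by rewrite mulr0.
have := cubic_monomial_degree i; rewrite E /= => h.
by move: (leq_trans p6 (leq_trans (leq_addr q p) h)).
Qed.

Lemma cubic_poly_inj : injective cubic_poly.
Proof.
by move=> a b E; apply/ffunP => i; rewrite -(coef_cubic_monomial a) E coef_cubic_monomial.
Qed.

Section Fixed.
Variables (x y : K) (xy : coordinates iota c x y).
Local Notation ev := (eval2 iota x y).

Lemma eval2_cubic_poly a : ev (cubic_poly a) =
  \sum_i iota (a i) * (x ^+ (cubic_monomial i).1 * y ^+ (cubic_monomial i).2).
Proof.
rewrite /cubic_poly rmorph_sum /=; apply: eq_bigr => i _.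
rewrite polyCM eval2M polyC_exp eval2M !eval2_exp eval2CC eval2X eval2Y.
by ring.
Qed.

Lemma eval2_small_inj (G H : R2) : (size G <= 6)%N -> (size H <= 6)%N ->
  ev G = ev H -> G = H.
Proof.
move=> sG sH /eqP; rewrite -subr_eq0 -eval2B => /eqP /xy.1 [h hE].
have [h0|h0] := eqVneq h 0; first by apply: subr0_eq; rewrite hE h0 mul0r.
have : (size (G - H)%R <= 6)%N.
  by rewrite (leq_trans (size_polyD _ _)) // geq_max sG size_polyN.
rewrite hE size_Mmonic ?sextic_monic // size_sextic.
by move: h0; rewrite -size_poly_gt0; move: (size _) => n; lia.
Qed.

Lemma eval2_reduce G : exists2 G1 : R2, (size G1 <= 6)%N & ev G = ev G1.
Proof.
have fm := sextic_monic c.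
exists (Pdiv.CommonRing.rmodp G f).
  by have := Pdiv.CommonRing.ltn_rmodp G f; rewrite size_sextic monic_neq0.
rewrite {1}(Pdiv.RingMonic.rdivp_eq fm G) eval2D eval2M (coordinates_eq xy).
by rewrite mulr0 add0r.
Qed.

End Fixed.

Section Basis.
Variables (x y : K) (xy : coordinates iota c x y).
Local Notation ev := (eval2 iota x y).

(** The basis consists of the x^i y^j dx / f_Y with i + j at most 3. Monomials of
   X-degree less than 6 are independent modulo f, which gives uniqueness. *)
Lemma sextic_genus : (exists O, valuation_ring iota O) -> has_genus iota 10.
Proof.
move=> [O0 vO0]; have [D [DX DY]] := jacobian_derivation_exists xy.
have DJ : jacobian_derivation c x y D by [].
have dY0 := eval2_sexticY_neq0 six0 c0 xy; have y0 := coordinate_y_neq0 six0 c0 xy.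
have ws := coordinates_infinity six0 c0 xy.
have DJ' := jacobian_infinity six0 c0 xy DJ.
pose form H : derivation iota -> K := fun D' => H * (D' x / ev (sexticY c)).
have form_hom H : homogeneous (form H).
  by move=> a D1 D2 pa; rewrite /form pa; ring.
have formD H : form H D = H by rewrite /form DX divff ?mulr1.
pose e (i : 'I_10) :=
  form (x ^+ (cubic_monomial i).1 * y ^+ (cubic_monomial i).2).
have eE (a : {ffun 'I_10 -> k}) :
    (fun D' => \sum_(i < 10) iota (a i) * e i D') = form (ev (cubic_poly a)).
  apply/funext => D'; rewrite eval2_cubic_poly /form mulr_suml.
  by apply: eq_bigr => i _; rewrite /e /form mulrA.
exists e; split=> [a O vO|w rw].
  rewrite eE; have [[Ox Oy]|[Ow [Os _]]] := place_center six0 c0 xy vO.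
    apply/(regular_atP six0 c0 xy DJ vO Ox Oy) => //; rewrite formD.
    exact: (place_eval vO Ox Oy).
  apply/(regular_atP six0 c0 ws DJ' vO Ow Os) => //.
  rewrite (form_hom _ (- y^-1 ^+ 3) _ D) // formD eval2_cubic_poly mulr_sumr.
  elim/big_ind: _ => [|u v|i _]; first exact: (valuation_ring0 vO).
    exact: (valuation_ringD vO).
  have deg := cubic_monomial_degree i; move: (cubic_monomial i) deg => [p q] /= pq.
  have -> : - y^-1 ^+ 3 * (iota (a i) * (x ^+ p * y ^+ q)) =
      - (iota (a i) * ((x / y) ^+ p * y^-1 ^+ (3 - (p + q)))).
    rewrite -{1}(subnK pq) !exprD !exprMn !exprVn.
    by field; rewrite !expf_neq0.
  apply: (valuation_ringN vO); apply: (valuation_ring_mul vO).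
    exact: (valuation_ring_const vO).
  by apply: (valuation_ring_mul vO); apply: (valuation_ringX vO).
have hw : homogeneous w.
  by have [s _ ->] := rw O0 vO0; exact: differential_homogeneous.
have wE : w = form (w D).
  apply/funext => D'; have [a pa] := jacobian_proportional six0 c0 xy DJ D'.
  rewrite (hw _ _ _ pa) /form pa DX mulfK //; exact: mulrC.
have [|G GE] := @regular_functions _ _ _ _ six0 c0 x y xy (w D).
  by move=> O vO Ox Oy; apply/(regular_atP six0 c0 xy DJ vO Ox Oy hw)/rw.
have [|E EE] := @regular_functions _ _ _ _ six0 c0 _ _ ws (w D * y^-1 ^+ 3).
  move=> O vO Ow Os; have := rw O vO.
  move/(regular_atP six0 c0 ws DJ' vO Ow Os hw) => /(valuation_ringN vO).
  rewrite (hw (- y^-1 ^+ 3) _ D) // mulNr opprK mulrC; exact.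
have [G1 sG1 G1E] := eval2_reduce xy G.
have [E1 sE1 E1E] := eval2_reduce ws E.
have G1E1 : ev G1 * y^-1 ^+ 3 = eval2 iota (x / y) y^-1 E1.
  by rewrite -G1E -GE -E1E -EE.
have G1c := cubic_polyP (pole_order_degree six0 c0 xy sG1 sE1 G1E1).
set a := finfun _ in G1c; exists a; split.
  by rewrite eE -G1c -G1E -GE.
move=> b wb; apply: cubic_poly_inj; rewrite -G1c.
apply: (eval2_small_inj xy sG1 (size_cubic_poly b)).
have bE : form (ev (cubic_poly b)) = w by rewrite -eE -wb.
by rewrite -G1E -GE -(formD (ev (cubic_poly b))) bE.
Qed.
End Basis.
End Genus.

(** * Rational places *)

Section RationalPlaces.
Local Open Scope classical_set_scope.
Local Open Scope card_scope.
Local Open Scope ring_scope.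

Lemma finite_pred_card (T : finType) (A : {pred T}) : [set x | x \in A] #= `I_#|A|.
Proof.
have [x0 _|A0] := pickP A; last first.
  have -> : #|A| = 0%N by apply: eq_card0.
  have -> : [set x | x \in A] = set0.
    by apply/seteqP; split=> // x /=; rewrite unfold_in A0.
  by rewrite II0.
have -> : [set x | x \in A] = [set nth x0 (enum A) i | i in `I_#|A|].
  apply/seteqP; split=> [x /= xA|_ [i /= iA <-]].
    exists (index x (enum A)); rewrite /= ?nth_index ?mem_enum //.
    by rewrite cardE index_mem mem_enum.
  by rewrite -mem_enum mem_nth // -cardE.
apply: inj_card_eq => i j /set_mem /= iA /set_mem /= jA /eqP.
by rewrite nth_uniq ?enum_uniq -?cardE // => /eqP.
Qed.

Section RationalPoints.
Variables (k : finFieldType) (K : fieldType) (iota : {rmorphism k -> K}).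
Variables (c : k).
Hypotheses (six0 : 6%:R != 0 :> k) (c0 : c ^+ 3 + 27%:R != 0).
Local Notation f := (U_eqn c).
Local Notation R2 := {poly {poly k}}.
Local Notation value := (@eval2 k k (@idfun k)).

Definition on_curve (a b : k) := a ^+ 6 + b ^+ 6 + 1 + c * a ^+ 2 * b ^+ 2 == 0.

Definition vanishing_ideal (a b : k) : set R2 := [set g | value a b g = 0].

Lemma vanishing_point_ideal a b : on_curve a b -> point_ideal c (vanishing_ideal a b).
Proof.
move=> /eqP ab; rewrite /vanishing_ideal; split=> /=.
- by rewrite eval2_sextic.
- by move=> g h g0 h0; rewrite eval2D g0 h0 addr0.
- by move=> g h h0; rewrite eval2M h0 mulr0.
- by rewrite (eval2_nat idfun a b 1); apply/eqP; apply: oner_neq0.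
- by move=> g h; rewrite eval2M => /eqP; rewrite mulf_eq0 => /orP [] /eqP; [left|right].
have n0 : 'X - b%:P != 0 by rewrite -size_poly_eq0 size_XsubC.
exists ('X - b%:P)%:P; last exact: polyC_not_multiple n0.
by rewrite /= polyCB eval2B eval2Y eval2CC subrr.
Qed.

Section Chart.
Variables (x y : K) (xy : coordinates iota c x y).
Local Notation ev := (eval2 iota x y).

Lemma local_ring_maximal m g h : point_ideal c m -> m g -> ~ m h ->
  maximal_ideal (local_ring iota x y m) (ev g / ev h).
Proof.
move=> im mg mh; have h0 := eval2_notin xy im mh.
split; first by exists g, h; rewrite divfK.
have [g0|g0] := eqVneq (ev g) 0; [by left; rewrite g0 mul0r | right].
move=> [g' [h' [mh' E]]].
have : m (h * h').
  apply: (eval2_in xy im (g := g' * g)); last first.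
    exact: (idealM im).
  by rewrite !eval2M -E invf_div mulrAC divfK // mulrC.
by move=> /(ideal_prime im) [].
Qed.

(** The residue of g / h is the quotient of the values of g and h at (a, b). *)
Lemma rational_local_ring a b : on_curve a b ->
  rational_points iota (local_ring iota x y (vanishing_ideal a b)).
Proof.
move=> ab; have im := vanishing_point_ideal ab; split.
  exact: (local_ring_valuation six0 c0 xy im).
move=> z [g [h [mh E]]]; have h0 := eval2_notin xy im mh.
have vh0 : value a b h != 0 by apply/eqP.
pose d := value a b g / value a b h; exists d.
have -> : z - iota d = ev (g - d%:P%:P * h) / ev h.
  by rewrite eval2B eval2M eval2CC -E mulrBl !mulfK.
apply: local_ring_maximal => //.
by rewrite /vanishing_ideal /= eval2B eval2M eval2CC /d divfK // subrr.
Qed.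

Lemma rational_local_ring_x a b : on_curve a b ->
  maximal_ideal (local_ring iota x y (vanishing_ideal a b)) (x - iota a).
Proof.
move=> ab; have im := vanishing_point_ideal ab.
have -> : x - iota a = ev ('X - a%:P%:P) / ev 1.
  by rewrite eval2B eval2X eval2CC (eval2_nat iota x y 1) divr1.
apply: local_ring_maximal => //; last exact: (ideal1 im).
by rewrite /vanishing_ideal /= eval2B eval2X eval2CC subrr.
Qed.

Lemma rational_local_ring_y a b : on_curve a b ->
  maximal_ideal (local_ring iota x y (vanishing_ideal a b)) (y - iota b).
Proof.
move=> ab; have im := vanishing_point_ideal ab.
have -> : y - iota b = ev ('Y - b%:P%:P) / ev 1.
  by rewrite eval2B eval2Y eval2CC (eval2_nat iota x y 1) divr1.
apply: local_ring_maximal => //; last exact: (ideal1 im).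
by rewrite /vanishing_ideal /= eval2B eval2Y eval2CC subrr.
Qed.

Lemma maximal_ideal_const (O : set K) d : valuation_ring iota O ->
  maximal_ideal O (iota d) -> d = 0.
Proof.
move=> vO md; apply: contrapT => /eqP d0; apply: (maximal_idealN1 vO).
have -> : 1 = iota d^-1 * iota d by rewrite -rmorphM mulVf ?rmorph1.
by apply: (maximal_ideal_mul vO) => //; apply: (valuation_ring_const vO).
Qed.

(** The residues a and b of x and y determine the center, which consists of the
   polynomials vanishing at (a, b), and the center determines the place. *)
Lemma rational_place (O : set K) : rational_points iota O -> O x -> O y ->
  exists a b, [/\ on_curve a b, O = local_ring iota x y (vanishing_ideal a b)
    & maximal_ideal O (y - iota b)].
Proof.
move=> [vO res] Ox Oy; have [a xa] := res x Ox; have [b yb] := res y Oy.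
have value_ev g : maximal_ideal O (ev g - iota (value a b g)).
  have mD u v : maximal_ideal O u -> maximal_ideal O v -> maximal_ideal O (u + v).
    exact: (maximal_idealD vO).
  have step (e u : K) (v d : k) : O u -> maximal_ideal O (e - iota v) ->
      maximal_ideal O (u - iota d) -> maximal_ideal O (e * u - iota (v * d)).
    move=> Ou mv md.
    have -> : e * u - iota (v * d) = u * (e - iota v) + iota v * (u - iota d).
      by rewrite rmorphM; ring.
    apply: mD; apply: (maximal_ideal_mul vO) => //.
    exact: (valuation_ring_const vO).
  have max0 : maximal_ideal O 0 by split; [apply: (valuation_ring0 vO) | left].
  have stepD (e u : K) (v d : k) : maximal_ideal O (e - iota v) ->
      maximal_ideal O (u - iota d) -> maximal_ideal O (e + u - iota (v + d)).
    move=> mv md; have -> : e + u - iota (v + d) = (e - iota v) + (u - iota d).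
      by rewrite rmorphD; ring.
    exact: mD.
  have valC (C : {poly k}) : maximal_ideal O (ev C%:P - iota (value a b C%:P)).
    elim/poly_ind: C => [|C d IH]; first by rewrite !rmorph0 subr0.
    rewrite polyCD polyCM !eval2D !eval2M !eval2Y !eval2CC.
    by apply: stepD; [apply: step | rewrite subrr].
  elim/poly_ind: g => [|g C IH]; first by rewrite !rmorph0 subr0.
  by rewrite !eval2D !eval2M !eval2X; apply: stepD => //; apply: step.
have cE : center iota x y O = vanishing_ideal a b.
  apply/seteqP; split=> g; rewrite /center /vanishing_ideal /= => mg.
    apply: (maximal_ideal_const vO).
    have -> : iota (value a b g) = ev g + (-1) * (ev g - iota (value a b g)) by ring.
    apply: (maximal_idealD vO) => //; apply: (maximal_ideal_mul vO) => //.
    by apply: (valuation_ringN vO); apply: (valuation_ring1 vO).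
  by have := value_ev g; rewrite mg rmorph0 subr0.
exists a, b; split=> //; last by rewrite -cE; exact: (place_local_ring six0 c0 xy vO Ox Oy).
have := ideal_eqn (center_point_ideal xy vO Ox Oy).
by rewrite cE /vanishing_ideal /= eval2_sextic => /eqP.
Qed.

End Chart.

Definition curve_point : {pred (k * k) + k} :=
  fun P => match P with inl ab => on_curve ab.1 ab.2 | inr w => on_curve w 0 end.

(** The left summand of the index type holds the affine points (a, b), the right
   one the points (w : 1 : 0) at infinity, where 1/y vanishes and x/y = w. *)
Lemma rational_points_card x y : coordinates iota c x y ->
  rational_points iota #= `I_#|curve_point|.
Proof.
move=> xy; have ws := coordinates_infinity six0 c0 xy.
have y0 := coordinate_y_neq0 six0 c0 xy.
pose place (P : (k * k) + k) := match P with
  | inl ab => local_ring iota x y (vanishing_ideal ab.1 ab.2)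
  | inr w => local_ring iota (x / y) y^-1 (vanishing_ideal w 0) end.
have -> : rational_points iota = [set place P | P in [set P | P \in curve_point]].
  apply/seteqP; split=> [O rO|_ [[[a b]|w] /= cP <-]]; last 2 first.
  - exact: (rational_local_ring xy).
  - exact: (rational_local_ring ws).
  have vO := rO.1; have [[Ox Oy]|[Ow ms]] := place_center six0 c0 xy vO.
    have [a [b [ab OE _]]] := rational_place xy rO Ox Oy.
    by exists (inl (a, b)).
  have [w [b [wb OE mb]]] := rational_place ws rO Ow ms.1.
  have b0 : b = 0.
    apply: (maximal_ideal_const vO).
    have -> : iota b = y^-1 + (-1) * (y^-1 - iota b) by ring.
    apply: (maximal_idealD vO) => //; apply: (maximal_ideal_mul vO) => //.
    by apply: (valuation_ringN vO); apply: (valuation_ring1 vO).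
  by exists (inr w); rewrite b0 in wb OE.
apply/(card_eq_trans _ (finite_pred_card curve_point)); apply: inj_card_eq.
have diff (O : set K) u d d' : valuation_ring iota O ->
    maximal_ideal O (u - iota d) -> maximal_ideal O (u - iota d') -> d = d'.
  move=> vO md md'; apply: subr0_eq; apply: (maximal_ideal_const vO).
  have -> : iota (d - d') = (u - iota d') + (-1) * (u - iota d) by rewrite rmorphB; ring.
  apply: (maximal_idealD vO) => //; apply: (maximal_ideal_mul vO) => //.
  by apply: (valuation_ringN vO); apply: (valuation_ring1 vO).
have disj a b w : on_curve a b -> on_curve w 0 -> place (inl (a, b)) <> place (inr w).
  move=> ab w0 E; have [vO _] := rational_local_ring xy ab.
  have := rational_local_ring_y ws w0; rewrite rmorph0 subr0.
  rewrite -[local_ring _ _ _ _]/(place (inr w)) -E => my.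
  have Oy : place (inl (a, b)) y.
    have := local_ring_eval iota x y 'Y (vanishing_point_ideal ab).
    by rewrite eval2Y.
  apply: (maximal_idealN1 vO); rewrite -(mulfV y0).
  exact: (maximal_ideal_mul vO).
move=> [[a b]|w] [[a' b']|w'] /set_mem /= P1 /set_mem /= P2 E.
- have [vO _] := rational_local_ring xy P1.
  have m1 := rational_local_ring_x xy P1; have m2 := rational_local_ring_x xy P2.
  have m3 := rational_local_ring_y xy P1; have m4 := rational_local_ring_y xy P2.
  rewrite /= -E in m2 m4.
  have /= -> := diff _ _ _ _ vO m1 m2.
  by have /= -> := diff _ _ _ _ vO m3 m4.
- by case: (disj _ _ _ P1 P2 E).
- by case: (disj _ _ _ P2 P1 (esym E)).
have [vO _] := rational_local_ring ws P1.
have m1 := rational_local_ring_x ws P1; have m2 := rational_local_ring_x ws P2.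
rewrite /= -E in m2.
by rewrite (diff _ _ _ _ vO m1 m2).
Qed.

End RationalPoints.

End RationalPlaces.

(** * Quadratic characters of finite fields *)

Section QuadraticCharacter.
Variable F : finFieldType.
Hypothesis odd_F : odd #|F|.
Local Notation h := (#|F|./2).

Lemma card_half : #|F| = h.*2.+1.
Proof. by rewrite -[LHS]odd_double_half odd_F. Qed.

Lemma expf_pred x : x != 0 -> x ^+ h.*2 = 1 :> F.
Proof.
by move=> x0; apply: (mulfI x0); rewrite -exprS -card_half expf_card mulr1.
Qed.

(** The multiplicative group is cyclic, of order 2 h. *)
Lemma primitive_element : exists g : F, (h.*2).-primitive_root g.
Proof.
have F1 : (0 < h.*2)%N.
  by rewrite -ltnS -card_half card_finNzRing_gt1.
have := @has_prim_root F (h.*2) (enum [pred x : F | x != 0]) F1.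
have -> : all (h.*2).-unity_root (enum [pred x : F | x != 0]).
  apply/allP => x; rewrite mem_enum inE unity_rootE => x0.
  by rewrite expf_pred.
rewrite enum_uniq -cardE => /(_ isT isT).
rewrite (_ : #|_| = h.*2) ?leqnn => [/(_ isT) /hasP [g _]|]; first by exists g.
have <- : #|predC1 (0 : F)| = h.*2 by rewrite cardC1 [X in X.-1]card_half.
by apply: eq_card => x; rewrite !inE.
Qed.

(** Otherwise 1 would be the only square root of 1, whereas g^h is another. *)
Lemma two_neq0 : 2%:R != 0 :> F.
Proof.
apply/eqP => two0; have [g gp] := primitive_element.
have h0 : (0 < h)%N by have := prim_order_gt0 gp; rewrite double_gt0.
have : (g ^+ h - 1) ^+ 2 == 0.
  have gg : (g ^+ h) ^+ 2 = 1 by rewrite -exprM muln2 (prim_expr_order gp).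
  by rewrite sqrrB1 gg -mulr_natl two0 mul0r subr0 -mulr2n two0.
rewrite sqrf_eq0 subr_eq0 -(prim_order_dvd gp) => /(dvdn_leq h0).
by rewrite -addnn -[X in (_ <= X)%N]addn0 leq_add2l leqNgt h0.
Qed.

(** Euler's criterion: for a primitive g, z = g^i is a square exactly when i is
    even, that is, when the order 2 h of g divides i h. *)
Lemma euler_criterion (z : F) : z != 0 -> (exists w, w ^+ 2 = z) <-> z ^+ h = 1.
Proof.
move=> z0; have [g gp] := primitive_element.
have gen x : x != 0 -> exists i, x = g ^+ i.
  by move=> /expf_pred/(prim_rootP gp) [i ->]; exists i.
split=> [[w wz]|].
  have w0 : w != 0 by apply: contraNneq z0 => w0; rewrite -wz w0 expr0n.
  by rewrite -wz -exprM mul2n expf_pred.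
have [i ->] := gen z z0; rewrite -exprM => /eqP.
rewrite -(prim_order_dvd gp) -mul2n => d.
have h0 : (0 < h)%N by have := prim_order_gt0 gp; rewrite double_gt0.
rewrite dvdn_pmul2r // in d.
by exists (g ^+ (i %/ 2)); rewrite -exprM divnK.
Qed.

Definition quad_char (z : F) : int :=
  if z == 0 then 0 else if [exists w, w ^+ 2 == z] then 1 else - 1.

Lemma quad_char0 : quad_char 0 = 0.
Proof. by rewrite /quad_char eqxx. Qed.

Lemma quad_char_euler z : z != 0 ->
  quad_char z = if z ^+ h == 1 then 1 else -1.
Proof.
move=> z0; rewrite /quad_char (negPf z0); congr (if _ then _ else _).
apply/existsP/eqP => [[w /eqP wz]|zh]; first by apply/(euler_criterion z0); exists w.
by have [w wz] := (euler_criterion z0).2 zh; exists w; apply/eqP.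
Qed.

Lemma half_power (z : F) : z != 0 -> z ^+ h = 1 \/ z ^+ h = -1.
Proof.
move=> z0; have : (z ^+ h) ^+ 2 = 1.
  by rewrite -exprM muln2 expf_pred.
by move/eqP; rewrite sqrf_eq1 => /orP [] /eqP; [left|right].
Qed.

Lemma neg1_neq1 : ((-1 : F) == 1) = false.
Proof. by rewrite eq_sym -subr_eq0 opprK -mulr2n (negPf two_neq0). Qed.

Lemma quad_charM z w : quad_char (z * w) = quad_char z * quad_char w.
Proof.
have [->|z0] := eqVneq z 0; first by rewrite mul0r quad_char0 mul0r.
have [->|w0] := eqVneq w 0; first by rewrite mulr0 quad_char0 mulr0.
rewrite !quad_char_euler ?mulf_neq0 // exprMn.
by case: (half_power z0) => ->; case: (half_power w0) => ->;
  rewrite ?mulrNN ?mulN1r ?mulrN1 ?mulr1 ?eqxx ?neg1_neq1 ?eqxx.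
Qed.

Lemma quad_char_sqr z : z != 0 -> quad_char (z ^+ 2) = 1.
Proof.
move=> z0; rewrite /quad_char expf_eq0 (negPf z0) /=.
by case: existsP => // -[]; exists z.
Qed.

Lemma quad_charV z : quad_char z^-1 = quad_char z.
Proof.
have [->|z0] := eqVneq z 0; first by rewrite invr0.
have -> : z^-1 = z * z^-1 ^+ 2 by rewrite expr2 mulrA divff ?mul1r.
by rewrite quad_charM quad_char_sqr ?mulr1 // invr_eq0.
Qed.

Lemma card_sqrt z : #|[pred w : F | w ^+ 2 == z]|%:Z = 1 + quad_char z.
Proof.
rewrite /quad_char; have [->|z0] := eqVneq z 0.
  rewrite addr0 (_ : #|_| = 1%N) // -(card1 (0 : F)); apply: eq_card => w.
  by rewrite !inE expf_eq0.
case: existsP => [[w /eqP wz]|nz].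
  have w0 : w != 0 by apply: contraNneq z0 => w0; rewrite -wz w0 expr0n.
  have ww : w != - w.
    by rewrite -subr_eq0 opprK -mulr2n -mulr_natl mulf_neq0 ?two_neq0.
  have := card2 w (- w); rewrite ww => E.
  rewrite (_ : #|_| = 2%N) // -[RHS]E; apply: eq_card => u.
  by rewrite !inE -wz -subr_eq0 subr_sqr mulf_eq0 subr_eq0 addr_eq0.
rewrite addrN (_ : #|_| = 0%N) //; apply: eq_card0 => w; rewrite !inE.
by apply/negP => wz; apply: nz; exists w.
Qed.

(** The n-th roots of unity all lie in F, and the solutions are their
   multiples by u. *)
Lemma card_roots_of_unity n (u : F) : (n %| h.*2)%N -> u != 0 ->
  #|[pred w : F | w ^+ n == u ^+ n]| = n.
Proof.
move=> nh u0; have [g gp] := primitive_element.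
have n0 : (0 < n)%N by apply: dvdn_gt0 nh; exact: prim_order_gt0 gp.
have zp := dvdn_prim_root gp nh; set z := g ^+ _ in zp.
have inj : injective (fun i : 'I_n => u * z ^+ i).
  move=> i j /(mulfI u0) /eqP; rewrite (eq_prim_root_expr zp) !modn_small ?ltn_ord //.
  by move/eqP/val_inj.
rewrite -[RHS]card_ord -(card_codom inj); apply: eq_card => w; rewrite !inE.
apply/eqP/codomP => [wu|[i ->]]; last first.
  by rewrite exprMn exprAC (prim_expr_order zp) expr1n mulr1.
have : (w / u) ^+ n = 1 by rewrite expr_div_n wu divff // expf_neq0.
by move/(prim_rootP zp) => [i E]; exists i; rewrite -E mulrC divfK.
Qed.

End QuadraticCharacter.

(** * Point counts as character sums *)

Lemma card_int (T : finType) (A : pred T) : #|A|%:Z = \sum_(x | A x) 1.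
Proof. by rewrite sumr_const natz. Qed.

Section Count.
Variables (k : finFieldType) (c : k).
Hypotheses (odd_k : odd #|k|) (k12 : (12 %| #|k|.-1)%N).
Hypotheses (three0 : 3%:R != 0 :> k) (c0 : c ^+ 3 + 27%:R != 0).
Local Notation chi := (@quad_char k).

Let two0 : 2%:R != 0 :> k := two_neq0 odd_k.

Let pred_card : #|k|.-1 = (#|k|./2).*2.
Proof. by rewrite [in LHS](card_half odd_k). Qed.

Lemma quad_charN1 : chi (-1) = 1.
Proof.
rewrite quad_char_euler ?oppr_eq0 ?oner_eq0 // -signr_odd.
have -> : odd #|k|./2 = false; last by rewrite expr0 eqxx.
move: k12; rewrite pred_card => /dvdnP [m]; move: (#|k|./2) => n; lia.
Qed.

Lemma card_sixth_roots : #|[pred w : k | on_curve c w 0]| = 6.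
Proof.
have d4 : (4 %| #|k|./2.*2)%N by rewrite -pred_card (dvdn_trans _ k12).
have d12 : (6 %| #|k|./2.*2)%N by rewrite -pred_card (dvdn_trans _ k12).
have [u u2] : exists u : k, u ^+ 2 = -1.
  apply/(euler_criterion odd_k); first by rewrite oppr_eq0 oner_eq0.
  apply/eqP; have := quad_charN1; rewrite quad_char_euler ?oppr_eq0 ?oner_eq0 //.
  by case: eqP.
have u0 : u != 0.
  by apply: contra_eq_neq u2 => ->; rewrite expr0n /= eq_sym oppr_eq0 oner_eq0.
rewrite -[RHS](card_roots_of_unity odd_k d12 u0); apply: eq_card => w.
have u6 : u ^+ 6 = -1 by rewrite (exprM u 2 3) u2 -signr_odd expr1.
by rewrite !inE /on_curve u6 !expr0n /= mulr0 !addr0 addr_eq0.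
Qed.

Definition cubic_eqn (s t : k) := s ^+ 3 + t ^+ 3 + 1 + c * s * t == 0.

Lemma on_curve_sqr x y : on_curve c x y = cubic_eqn (x ^+ 2) (y ^+ 2).
Proof. by rewrite /on_curve /cubic_eqn -!exprM. Qed.

Lemma sum_sqr (g : k -> int) :
  \sum_(x | x != 0) g (x ^+ 2) = \sum_(s | s != 0) (1 + chi s) * g s.
Proof.
rewrite (partition_big (fun x => x ^+ 2) (fun s => s != 0)) /=; last first.
  by move=> x x0; rewrite expf_neq0.
apply: eq_bigr => s s0; rewrite -(card_sqrt odd_k) card_int mulr_suml.
rewrite (eq_bigl (fun x => x ^+ 2 == s)).
  by apply: eq_bigr => x /eqP ->; rewrite mul1r.
move=> x /=; apply: andb_idl => /eqP E.
by apply: contraNneq s0 => x0; rewrite -E x0 expr0n.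
Qed.

Definition torus_point (P : k * k) := [&& P.1 != 0, P.2 != 0 & cubic_eqn P.1 P.2].

(** Both axes and the line at infinity contain 6 rational points each, given by
   the sixth roots of -1; the other points (x, y) are the square roots of the points
   (x^2, y^2) of the cubic. *)
Lemma card_curve_point : #|curve_point c|%:Z =
  18 + \sum_(P | torus_point P) (1 + chi P.1) * (1 + chi P.2).
Proof.
rewrite card_int big_sumType /=.
have six : \sum_(w : k | on_curve c w 0) (1 : int) = 6.
  by rewrite -card_int card_sixth_roots.
rewrite six; have -> : (18%R : int) = (12 + 6)%R by [].
rewrite -addrA [6 + _]addrC addrA; congr (_ + _).
have -> : \sum_(P : k * k | on_curve c P.1 P.2) (1 : int) =
    \sum_x \sum_y ((on_curve c x y)%:R : int).
  rewrite pair_bigA /= [LHS]big_mkcond /=; apply: eq_bigr => P _.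
  by case: on_curve.
rewrite (bigD1 0) //=.
have oc0 w : on_curve c 0 w = on_curve c w 0.
  by rewrite /on_curve !expr0n /= !(mulr0, mul0r, addr0, add0r).
have ind (A : pred k) : \sum_x (A x)%:R = \sum_(x | A x) (1 : int).
  by rewrite [RHS]big_mkcond /=; apply: eq_bigr => x _; case: (A x).
rewrite (eq_bigr (fun w => (on_curve c w 0)%:R)); last by move=> w _; rewrite oc0.
rewrite ind six (eq_bigr (fun x => (on_curve c x 0)%:R +
  \sum_(y | y != 0) (on_curve c x y)%:R)); last first.
  by move=> x _; rewrite (bigD1 0).
rewrite big_split /= addrA.
have -> : \sum_(x | x != 0) ((on_curve c x 0)%:R : int) = 6.
  have := ind [pred x | on_curve c x 0]; rewrite six (bigD1 0) //= => <-.
  by rewrite /on_curve !expr0n /= mulr0 !addr0 add0r oner_eq0 add0r.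
congr (_ + _).
transitivity (\sum_(s | s != 0) \sum_(t | t != 0)
    (1 + chi s) * ((1 + chi t) * (cubic_eqn s t)%:R)).
  have := sum_sqr (fun s => \sum_(t | t != 0) (1 + chi t) * (cubic_eqn s t)%:R).
  rewrite /= => E; transitivity (\sum_(s | s != 0) (1 + chi s) *
      \sum_(t | t != 0) (1 + chi t) * (cubic_eqn s t)%:R).
    rewrite -E; apply: eq_bigr => x _.
    have := sum_sqr (fun t => (cubic_eqn (x ^+ 2) t)%:R); rewrite /= => <-.
    by apply: eq_bigr => y _; rewrite on_curve_sqr.
  by apply: eq_bigr => s _; rewrite mulr_sumr.
rewrite pair_big /=.
rewrite [RHS](eq_bigl (fun P => ((P.1 != 0) && (P.2 != 0)) && cubic_eqn P.1 P.2));
  last by move=> P; rewrite /torus_point andbA.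
rewrite [RHS]big_mkcondr /=; apply: eq_bigr => P _.
by case: cubic_eqn; rewrite ?mulr1 ?mulr0.
Qed.

(** The exchange of s and t, and the cyclic permutation (s, t) -> (1/t, s/t) of
   the homogeneous coordinates, preserve the cubic. The second one carries st
   to s / t^2, which has the character of s. *)
Lemma sum_torus_point : \sum_(P | torus_point P) (1 + chi P.1) * (1 + chi P.2) =
  \sum_(P | torus_point P) (1 + 3%:R * chi (P.1 * P.2)).
Proof.
have swap : \sum_(P | torus_point P) chi P.2 = \sum_(P | torus_point P) chi P.1.
  pose f (P : k * k) := (P.2, P.1).
  rewrite (reindex_onto f f) /= => [|[s t] _] //.
  apply: eq_bigl => -[s t]; rewrite /torus_point /cubic_eqn /f /= eqxx andbT.
  rewrite andbCA; congr [&& _, _ & _ == 0]; ring.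
have prod : \sum_(P | torus_point P) chi (P.1 * P.2) = \sum_(P | torus_point P) chi P.1.
  pose f (P : k * k) := (P.2^-1, P.1 / P.2); pose g (P : k * k) := (P.2 / P.1, P.1^-1).
  rewrite (reindex_onto f g) /= => [|[s t] /and3P [/= s0 t0 _]]; last first.
    by rewrite /f /g /= !invrK divfK.
  apply: etrans (eq_bigl torus_point _ _) _ => [[s t]|].
    rewrite /torus_point /cubic_eqn /f /g /=.
    have [->|t0] := eqVneq t 0; first by rewrite invr0 eqxx !andbF.
    have [->|s0] := eqVneq s 0; first by rewrite mul0r eqxx !andbF.
    rewrite !invr_eq0 t0 mulf_neq0 ?invr_eq0 //= invrK divfK // eqxx andbT.
    have -> : t^-1 ^+ 3 + (s / t) ^+ 3 + 1 + c * t^-1 * (s / t) =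
      (s ^+ 3 + t ^+ 3 + 1 + c * s * t) / t ^+ 3 by field.
    by rewrite mulf_eq0 invr_eq0 expf_eq0 /= (negPf t0) orbF.
  apply: eq_bigr => -[s t] /and3P [/= s0 t0 _].
  rewrite /f /= mulrCA -expr2 exprVn -[X in chi X]mulr1.
  by rewrite mulr1 quad_charM // quad_charV // quad_char_sqr // mulr1.
rewrite (eq_bigr (fun P => 1 + chi P.1 + chi P.2 + chi (P.1 * P.2))); last first.
  by move=> P _; rewrite quad_charM //; ring.
by rewrite !big_split /= -mulr_sumr swap prod; ring.
Qed.

Definition cubic_num (z : k) := z ^+ 3 + 1.
Definition cubic_den (z : k) := 3%:R * z - c.
Definition cubic_disc (z : k) := z ^+ 3 + c * z ^+ 2 + 4%:R.

(** The factor (e1 e2)^2 is 0 or 1 and removes the values of z for which there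
   is no pair (s, t) with s t different from 0. *)
Definition char_term (e1 e2 e3 : int) : int :=
  (e1 * e2) ^+ 2 * ((1 + e2 * e3) * (1 + 3%:R * (e1 * e2))).

(** The pairs with given sum and product correspond to the square roots s - t
   of the discriminant. *)
Lemma card_sum_product (z q : k) :
  #|[pred P : k * k | (P.1 + P.2 == z) && (P.1 * P.2 == q)]|%:Z =
  1 + chi (z ^+ 2 - 4%:R * q).
Proof.
rewrite -card_sqrt // !card_int.
pose f w : k * k := ((z + w) / 2%:R, (z - w) / 2%:R).
rewrite (reindex_onto f (fun P => P.1 - P.2)) /=; last first.
  by move=> [s t]; rewrite /f /= => /andP [/eqP <- _]; congr (_, _); field.
apply: eq_bigl => w; rewrite /=.
have -> : (z + w) / 2%:R + (z - w) / 2%:R = z by field.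
have -> : (z + w) / 2%:R - (z - w) / 2%:R = w by field.
rewrite !eqxx andbT /= -subr_eq0 -[RHS]subr_eq0.
have -> : (z + w) / 2%:R * ((z - w) / 2%:R) - q =
   - (w ^+ 2 - (z ^+ 2 - 4%:R * q)) * 2%:R^-1 ^+ 2 by field.
by rewrite mulf_eq0 expf_eq0 /= invr_eq0 (negPf two0) orbF oppr_eq0.
Qed.

(** With z = s + t and q = st the equation of the cubic is linear in q, namely
   q (3 z - c) = z^3 + 1. *)
Lemma sum_trace : \sum_(P | torus_point P) (1 + 3%:R * chi (P.1 * P.2)) =
  \sum_z char_term (chi (cubic_num z)) (chi (cubic_den z)) (chi (cubic_disc z)).
Proof.
rewrite (partition_big (fun P => P.1 + P.2) xpredT) //=; apply: eq_bigr => z _.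
have eqnE (P : k * k) : P.1 + P.2 = z ->
    cubic_eqn P.1 P.2 = (P.1 * P.2 * cubic_den z == cubic_num z).
  move=> <-; rewrite /cubic_eqn /cubic_den /cubic_num -[RHS]subr_eq0 -[RHS]oppr_eq0.
  by congr (_ == 0); ring.
have [d0|d0] := eqVneq (cubic_den z) 0.
  rewrite d0 quad_char0 /char_term mulr0 expr0n /= mul0r big_pred0 // => P.
  apply/negP => /andP [/and3P [_ _ E] /eqP Pz]; move: E; rewrite (eqnE _ Pz) d0 mulr0.
  move=> /eqP/esym n0; case/eqP: c0.
  have cE : c = 3%:R * z by apply/eqP; rewrite eq_sym -subr_eq0 -/(cubic_den z) d0.
  transitivity (27%:R * cubic_num z); last by rewrite n0 mulr0.
  by rewrite cE /cubic_num; ring.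
have [n0|n0] := eqVneq (cubic_num z) 0.
  rewrite n0 quad_char0 /char_term mul0r expr0n /= mul0r big_pred0 // => P.
  apply/negP => /andP [/and3P [s0 t0 E] /eqP Pz]; move: E; rewrite (eqnE _ Pz) n0.
  by rewrite !mulf_eq0 (negPf s0) (negPf t0) (negPf d0).
pose q := cubic_num z / cubic_den z.
rewrite (eq_bigl (fun P => (P.1 + P.2 == z) && (P.1 * P.2 == q))); last first.
  move=> P; rewrite andbC; case: eqP => //= Pz; rewrite /torus_point (eqnE _ Pz).
  have -> : (P.1 * P.2 == q) = (P.1 * P.2 * cubic_den z == cubic_num z).
    by rewrite -(inj_eq (mulIf d0)) divfK.
  rewrite andbA; apply: andb_idl => /eqP E.
  by rewrite -negb_or -mulf_eq0; apply: contraNneq n0 => E0; rewrite -E E0 mul0r.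
rewrite (eq_bigr (fun=> 1 * (1 + 3%:R * chi q))); last first.
  by move=> P /andP [_ /eqP ->]; rewrite mul1r.
rewrite -mulr_suml -card_int card_sum_product /char_term.
have qE : chi q = chi (cubic_num z) * chi (cubic_den z).
  by rewrite /q quad_charM // quad_charV.
have dE : chi (z ^+ 2 - 4%:R * q) = chi (cubic_den z) * chi (cubic_disc z).
  have -> : z ^+ 2 - 4%:R * q = (-1) * cubic_disc z / cubic_den z.
    by rewrite /q /cubic_disc /cubic_num; move: d0; rewrite /cubic_den => d0; field.
  by rewrite !quad_charM // quad_charN1 quad_charV // mul1r mulrC.
have sq1 : (chi (cubic_num z) * chi (cubic_den z)) ^+ 2 = 1.
  by rewrite -quad_charM // expr2 -quad_charM // -expr2 quad_char_sqr // mulf_neq0.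
by rewrite qE dE sq1 mul1r.
Qed.

End Count.

(** * Norms from a quadratic extension *)

Section QuadraticExtension.
Variables (p : nat) (k : finFieldType) (j : {rmorphism 'F_p -> k}).
Hypotheses (pp : prime p) (p_odd : odd p) (hk : #|k| = (p ^ 2)%N).
Variable d : 'F_p.
Hypothesis d_nonsq : quad_char d = -1.

Let odd_Fp : odd #|'F_p|.
Proof. by rewrite card_Fp. Qed.

Let odd_k : odd #|k|.
Proof. by rewrite hk oddX p_odd. Qed.

Let d0 : d != 0.
Proof. by apply: contra_eq_neq d_nonsq => ->; rewrite quad_char0. Qed.

Let half_k : #|k|./2 = (p.+1 * p./2)%N.
Proof.
have := odd_double_half p; rewrite p_odd hk; move: (p./2) => h <-.
by rewrite expnS expn1; lia.
Qed.

Let euler_d : d ^+ p./2 = -1.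
Proof.
have := d_nonsq; rewrite quad_char_euler // card_Fp //.
by case: (half_power odd_Fp d0); rewrite card_Fp // => ->; rewrite ?eqxx.
Qed.

(** The exponent (p^2 - 1) / 2 of Euler's criterion in k is the multiple by
   p + 1, an even number, of the exponent (p - 1) / 2 that sends d to -1. *)
Lemma nonsquare_sqrt : exists r : k, r ^+ 2 = j d.
Proof.
have jd0 : j d != 0 by rewrite fmorph_eq0.
apply/(euler_criterion odd_k jd0); rewrite half_k mulnC exprM -rmorphXn.
by rewrite euler_d -rmorphXn -signr_odd /= p_odd /= expr0 rmorph1.
Qed.

Variable r : k.
Hypothesis rd : r ^+ 2 = j d.

Let j_frob a : j a ^+ p = j a.
Proof. by have := expf_card a; rewrite card_Fp // => E; rewrite -rmorphXn E. Qed.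

Let r_frob : r ^+ p = - r.
Proof.
have -> : r ^+ p = r ^+ (2 * p./2).+1.
  by rewrite mul2n -[in LHS](odd_double_half p) p_odd.
rewrite exprSr exprM rd.
by rewrite -rmorphXn euler_d rmorphN1 mulN1r.
Qed.

(** Since r^p = - r, the power p + 1 of z = a + b r is its norm a^2 - d b^2,
   and (p^2 - 1) / 2 = (p + 1) (p - 1) / 2: Euler's criteria in k for z and in
   F_p for its norm coincide. *)
Lemma quad_char_ext a b : quad_char (j a + j b * r) = quad_char (a ^+ 2 - d * b ^+ 2).
Proof.
have nE : (j a + j b * r) ^+ p.+1 = j (a ^+ 2 - d * b ^+ 2).
  have pk : p \in [pchar k] by apply: (rmorph_pchar j); exact: pchar_Fp.
  rewrite exprS exprDn_pchar ?(pnatE _ pp) // exprMn !j_frob r_frob.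
  by rewrite !(rmorphXn, rmorphB, rmorphM) -rd; ring.
have z0 : (j a + j b * r == 0) = (a ^+ 2 - d * b ^+ 2 == 0).
  by rewrite -(fmorph_eq0 j) -nE expf_eq0.
have [z00|z00] := eqVneq (j a + j b * r) 0.
  by move: z0; rewrite z00 eqxx => /esym/eqP ->; rewrite !quad_char0.
rewrite !quad_char_euler // -?z0 // half_k exprM nE -rmorphXn card_Fp //.
by rewrite -(rmorph1 j) (inj_eq (fmorph_inj j)).
Qed.

Let pair_inj : injective (fun ab : 'F_p * 'F_p => j ab.1 + j ab.2 * r).
Proof.
move=> [a b] [a' b'] /= E.
have bb : b = b'.
  apply: subr0_eq; apply/eqP; apply: contraT => b0.
  have := d_nonsq; have -> : d = ((a' - a) / (b - b')) ^+ 2.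
    apply: (fmorph_inj j); rewrite -rd rmorphXn; congr (_ ^+ 2).
    have jb0 : j (b - b') != 0 by rewrite fmorph_eq0.
    rewrite fmorph_div; apply: (mulIf jb0); rewrite divfK // !rmorphB.
    apply: subr0_eq; transitivity (j a + j b * r - (j a' + j b' * r)); first by ring.
    by rewrite E subrr.
  rewrite expr2 quad_charM // -expr2 => /eqP.
  by rewrite -subr_eq0 opprK; move: (quad_char _) => e; have := sqr_ge0 e; lia.
by move: E; rewrite bb => /addIr /(fmorph_inj j) ->.
Qed.

Lemma sum_quadratic_extension (f : k -> int) :
  \sum_z f z = \sum_(a : 'F_p) \sum_(b : 'F_p) f (j a + j b * r).
Proof.
rewrite pair_bigA /=; apply: reindex; apply: onW_bij; apply: (inj_card_bij pair_inj).
by rewrite card_prod card_Fp // hk expnS expn1.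
Qed.

(** The norms to F_p of the three polynomials in z, expressed in the trace T and
   the norm n of z. *)
Definition norm_num (R : comNzRingType) (T n : R) := n ^+ 3 + T ^+ 3 - 3%:R * n * T + 1.
Definition norm_den (R : comNzRingType) (c T n : R) := 9%:R * n - 3%:R * c * T + c ^+ 2.
Definition norm_disc (R : comNzRingType) (c T n : R) :=
  n ^+ 3 + c * n ^+ 2 * T + c ^+ 2 * n ^+ 2 + 4%:R * (T ^+ 3 - 3%:R * n * T)
  + 4%:R * c * (T ^+ 2 - 2%:R * n) + 16%:R.

Lemma sum_char_term (c : 'F_p) :
  \sum_z char_term (quad_char (cubic_num z)) (quad_char (cubic_den (j c) z))
     (quad_char (cubic_disc (j c) z)) =
  \sum_(a : 'F_p) \sum_(b : 'F_p)
     char_term (quad_char (norm_num (2%:R * a) (a ^+ 2 - d * b ^+ 2)))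
       (quad_char (norm_den c (2%:R * a) (a ^+ 2 - d * b ^+ 2)))
       (quad_char (norm_disc c (2%:R * a) (a ^+ 2 - d * b ^+ 2))).
Proof.
rewrite sum_quadratic_extension; apply: eq_bigr => a _; apply: eq_bigr => b _.
have r3 : r ^+ 3 = j d * r by rewrite exprSr rd.
have -> : cubic_num (j a + j b * r) =
    j (a ^+ 3 + 3%:R * a * b ^+ 2 * d + 1) + j (3%:R * a ^+ 2 * b + b ^+ 3 * d) * r.
  rewrite /cubic_num !(rmorph_nat, rmorphXn, rmorphD, rmorphM, rmorph1) -rd.
  by ring.
have -> : cubic_den (j c) (j a + j b * r) = j (3%:R * a - c) + j (3%:R * b) * r.
  by rewrite /cubic_den !(rmorph_nat, rmorphB, rmorphM); ring.
have -> : cubic_disc (j c) (j a + j b * r) =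
    j (a ^+ 3 + 3%:R * a * b ^+ 2 * d + c * (a ^+ 2 + d * b ^+ 2) + 4%:R)
    + j (3%:R * a ^+ 2 * b + b ^+ 3 * d + 2%:R * a * b * c) * r.
  rewrite /cubic_disc !(rmorph_nat, rmorphXn, rmorphD, rmorphM) -rd.
  by ring.
rewrite !quad_char_ext /norm_num /norm_den /norm_disc.
by congr char_term; congr quad_char; ring.
Qed.

End QuadraticExtension.

(** * Evaluation of the character sum *)

(** Sets of positive numbers indexed by binary digits, for a table of squares
   with fast lookup. *)
Inductive bit_trie := Leaf | Node of bit_trie & bool & bit_trie.

Fixpoint trie_mem (t : bit_trie) (i : positive) : bool :=
  if t is Node l b r then
    match i with xH => b | xO i => trie_mem l i | xI i => trie_mem r i end
  else false.

Fixpoint trie_add (t : bit_trie) (i : positive) {struct i} : bit_trie :=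
  match i, t with
  | xH, Leaf => Node Leaf true Leaf
  | xH, Node l _ r => Node l true r
  | xO i, Leaf => Node (trie_add Leaf i) false Leaf
  | xO i, Node l b r => Node (trie_add l i) b r
  | xI i, Leaf => Node Leaf false (trie_add Leaf i)
  | xI i, Node l b r => Node l b (trie_add r i)
  end.

Lemma trie_addP t i i' : trie_mem (trie_add t i) i' = Pos.eqb i' i || trie_mem t i'.
Proof.
elim: i t i' => [i IH|i IH|] [|l b r] [i'|i'|] //=; rewrite ?IH //.
all: by rewrite ?orbF.
Qed.

Definition N_range (m n : nat) : seq N := [seq N.of_nat i | i <- iota m n].

Definition zsum (s : seq N) (F : N -> Z) : Z :=
  foldr (fun x acc => Z.add (F x) acc) Z0 s.

Definition squares (p : N) : bit_trie :=
  foldr (fun i t => if N.modulo (N.mul i i) p is Npos j then trie_add t j else t)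
    Leaf (N_range 0 (N.to_nat p)).

Definition legendre (t : bit_trie) (n : N) : Z :=
  match n with N0 => Z0 | Npos i => if trie_mem t i then Zpos 1 else Zneg 1 end.

(** The value of char_term on -1, 0 and 1, in binary arithmetic. *)
Definition weight (e1 e2 e3 : Z) : Z :=
  match e1, e2 with
  | Z0, _ | _, Z0 => Z0
  | _, _ => Z.mul (Z.add (Zpos 1) (Z.mul e2 e3))
              (Z.add (Zpos 1) (Z.mul (Zpos 3) (Z.mul e1 e2)))
  end.

(** The summand at z = a + b r, where m stands for - d b^2, so that the norm is
   n = a^2 + m and the trace T = 2 a. The three norms are polynomials in n whose
   coefficients depend only on a and are computed once for all b; - 3, - 8 and
   - 12 are represented by p - 3, p - 8 and p - 12. *)
Definition trace_norm_term (p c : N) (t : bit_trie) (a : N) : N -> Z :=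
  let T := (2 * a)%num in
  let u1 := ((p - 3) * T mod p)%num in let v1 := ((T * T * T + 1) mod p)%num in
  let v2 := (((p - 3) * c * T + c * c) mod p)%num in
  let u3 := ((c * T + c * c) mod p)%num in
  let w3 := (((p - 12) * T + (p - 8) * c) mod p)%num in
  let v3 := ((4 * T * T * T + 4 * c * T * T + 16) mod p)%num in
  fun m => let n := ((a * a + m) mod p)%num in
  weight (legendre t ((n * (n * n + u1) + v1) mod p)%num)
    (legendre t ((9 * n + v2) mod p)%num)
    (legendre t ((n * (n * (n + u3) + w3) + v3) mod p)%num).

(** The sum over b is folded by the symmetry b, - b: the term b = 0 plus twice
   the terms with 1 <= b <= (p - 1) / 2. *)
Definition character_total (p c d : N) : Z :=
  let t := squares p in
  let ms := [seq ((p - d) * b * b mod p)%num | b <- N_range 1 (N.to_nat p)./2] in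
  zsum (N_range 0 (N.to_nat p)) (fun a =>
    let F := trace_norm_term p c t a in Z.add (F N0) (Z.mul (Zpos 2) (zsum ms F))).

Definition character_check (p c d : N) : bool :=
  [&& Z.eqb (legendre (squares p) d) (Zneg 1),
      ~~ N.eqb ((c * c * c + 27) mod p)%num N0,
      N.ltb d p, N.leb 12%num p
    & Z.eqb (character_total p c d) (Z.sub (Z.of_N (p * p + 1 + 20 * p)%num) (Zpos 18))].


Section Correctness.
Variables (p : nat) (P : N).
Hypotheses (pp : prime p) (p_odd : odd p) (PE : N.to_nat P = p).

Definition residue (n : N) : 'F_p := (N.to_nat n)%:R.

Lemma residueD m n : residue (N.add m n) = residue m + residue n.
Proof. by rewrite /residue N2Nat.inj_add natrD. Qed.

Lemma residueM m n : residue (N.mul m n) = residue m * residue n.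
Proof. by rewrite /residue N2Nat.inj_mul natrM. Qed.

Lemma residueP : residue P = 0.
Proof. by rewrite /residue PE pchar_Fp_0. Qed.

Let P0 : P <> N0.
Proof. by move=> P0; move: pp; rewrite -PE P0. Qed.

Lemma residue_mod n : residue (N.modulo n P) = residue n.
Proof.
rewrite {2}(N.div_mod n P P0) residueD residueM residueP mul0r add0r.
by [].
Qed.

Lemma residueB m : N.le m P -> residue (N.sub P m) = - residue m.
Proof.
move=> mP; apply/eqP; rewrite -addr_eq0 -residueD N.sub_add // residueP.
by [].
Qed.

Lemma residue_val n : N.lt n P -> nat_of_ord (residue n) = N.to_nat n.
Proof. by move=> nP; rewrite /residue val_Fp_nat // modn_small // -PE; lia. Qed.

Lemma residue_inj m n : N.lt m P -> N.lt n P -> residue m = residue n -> m = n.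
Proof. by move=> mP nP E; apply: N2Nat.inj; rewrite -!residue_val // E. Qed.

Lemma residue_eq0 n : (residue n == 0) = N.eqb (N.modulo n P) N0.
Proof.
rewrite -residue_mod; apply/eqP/idP => [E|/N.eqb_eq ->]; last by [].
apply/N.eqb_eq; apply: residue_inj => //; first exact: N.mod_lt.
by apply: N.le_lt_trans (N.le_0_l _) (N.mod_lt n P P0).
Qed.

Lemma squaresP j :
  trie_mem (squares P) j = has (fun i => N.modulo (N.mul i i) P == Npos j) (N_range 0 p).
Proof.
rewrite /squares PE; elim: (N_range 0 p) => [|i s IH] //=.
case E: (N.modulo _ _) => [|l]; first by rewrite IH.
rewrite trie_addP IH; congr (_ || _).
by apply/idP/eqP => [/Pos.eqb_eq -> //|[->]]; rewrite Pos.eqb_refl.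
Qed.

Lemma legendreE n : N.lt n P ->
  int_of_Z (legendre (squares P) n) = quad_char (residue n).
Proof.
case: n => [|i] nP; first by rewrite quad_char0.
rewrite /quad_char residue_eq0 N.mod_small //= squaresP.
suff -> : has (fun l => N.modulo (N.mul l l) P == Npos i) (N_range 0 p) =
   [exists w, w ^+ 2 == residue (Npos i)] by case: ifP.
apply/hasP/existsP => [[l _ /eqP E]|[w /eqP E]].
  by exists (residue l); rewrite expr2 -residueM -residue_mod E.
exists (N.of_nat w).
  apply/mapP; exists (nat_of_ord w) => //; rewrite mem_iota /= add0n.
  by rewrite -{2}(card_Fp pp) card_ord.
have rw : residue (N.of_nat w) = w by rewrite /residue Nat2N.id natr_Zp.
apply/eqP; apply: residue_inj => //; first exact: N.mod_lt.
by rewrite residue_mod residueM rw -expr2.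
Qed.

Lemma int_of_Z_add x y : int_of_Z (Z.add x y) = int_of_Z x + int_of_Z y.
Proof. exact: (rmorphD int_of_Z). Qed.

Lemma int_of_Z_mul x y : int_of_Z (Z.mul x y) = int_of_Z x * int_of_Z y.
Proof. exact: (rmorphM int_of_Z). Qed.

Lemma weightE t n1 n2 e3 :
  int_of_Z (weight (legendre t n1) (legendre t n2) e3) =
  char_term (int_of_Z (legendre t n1)) (int_of_Z (legendre t n2)) (int_of_Z e3).
Proof.
have legP n : [\/ legendre t n = Z0, legendre t n = Zpos 1 | legendre t n = Zneg 1].
  by case: n => [|i] /=; [constructor 1 | case: ifP => _; [constructor 2|constructor 3]].
have Z0E : int_of_Z Z0 = 0 by [].
have Z1E : int_of_Z (Zpos 1) = 1 by [].
have ZN1E : int_of_Z (Zneg 1) = -1 by [].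
have Z3E : int_of_Z (Zpos 3) = 3%:R by [].
rewrite /char_term; case: (legP n1) => ->; case: (legP n2) => ->;
  by rewrite /weight ?(int_of_Z_mul, int_of_Z_add) ?(Z0E, Z1E, ZN1E, Z3E); ring.
Qed.

Lemma zsumE s F : int_of_Z (zsum s F) = \sum_(x <- s) int_of_Z (F x).
Proof.
elim: s => [|x s IH]; first by rewrite big_nil.
by rewrite big_cons -IH -int_of_Z_add.
Qed.

Lemma sum_Fp (g : 'F_p -> int) : \sum_(a : 'F_p) g a = \sum_(0 <= i < p) g i%:R.
Proof.
suff H n : n = (Zp_trunc (pdiv p)).+2 -> \sum_(a : 'F_p) g a = \sum_(0 <= i < n) g i%:R.
  by apply: H; rewrite -[RHS]card_ord (card_Fp pp).
by move=> ->; rewrite big_mkord; apply: eq_bigr => a _; rewrite natr_Zp.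
Qed.

(** The representatives above p / 2 are the opposites of those from 1 to
   (p - 1) / 2. *)
Lemma sum_Fp_even (g : 'F_p -> int) : (forall b, g (- b) = g b) ->
  \sum_(b : 'F_p) g b = g 0 + 2%:R * \sum_(1 <= i < (p./2).+1) g i%:R.
Proof.
move=> even; rewrite sum_Fp.
have pE : p = ((p./2).+1 + p./2)%N by rewrite -[LHS]odd_double_half p_odd -addnn.
have p0 : (0 < p)%N := prime_gt0 pp; have hp : ((p./2).+1 <= p)%N by rewrite {2}pE leq_addr.
rewrite big_ltn //; congr (_ + _).
rewrite (@big_cat_nat _ _ _ (p./2).+1) //= mulr_natl mulr2n; congr (_ + _).
rewrite big_nat_rev /= -[in X in index_iota X _](add1n p./2) big_addn.
have -> : (p - p./2)%N = (p./2).+1 by rewrite {1}pE addnK.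
rewrite [LHS]big_nat_cond [RHS]big_nat_cond; apply: eq_bigr => i /andP [/andP [i1 ih] _].
have -> : ((1 + p./2) + p - (i + p./2).+1 = p - i)%N.
  by move: p hp pE ih => q; move: (q./2) => h'; lia.
rewrite natrB ?(pchar_Fp_0 pp) ?sub0r ?even //.
by rewrite (leq_trans (ltnW ih)).
Qed.

Lemma trace_norm_termE c t a m : N.le 12%num P -> t = squares P ->
  int_of_Z (trace_norm_term P c t a m) =
  char_term (quad_char (norm_num (2%:R * residue a) (residue a ^+ 2 + residue m)))
    (quad_char (norm_den (residue c) (2%:R * residue a) (residue a ^+ 2 + residue m)))
    (quad_char (norm_disc (residue c) (2%:R * residue a) (residue a ^+ 2 + residue m))).
Proof.
move=> P12 ->; rewrite /trace_norm_term weightE !legendreE; try exact: N.mod_lt.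
have r3 : residue (P - 3)%num = - 3%:R by rewrite residueB //; lia.
have r12 : residue (P - 12)%num = - 12%:R by rewrite residueB //; lia.
have r8 : residue (P - 8)%num = - 8%:R by rewrite residueB //; lia.
have rn n : residue n = (N.to_nat n)%:R by [].
rewrite !(residue_mod, residueD, residueM) r3 r12 r8.
rewrite (rn 1%num) (rn 2%num) (rn 4%num) (rn 9%num) (rn 16%num).
rewrite -[N.to_nat 1]/1%N -[N.to_nat 2]/2%N -[N.to_nat 4]/4%N -[N.to_nat 9]/9%N.
rewrite -[N.to_nat 16]/16%N /norm_num /norm_den /norm_disc.
by congr char_term; congr quad_char; ring.
Qed.

Lemma big_N_range (m n : nat) (g : N -> int) :
  \sum_(x <- N_range m n) g x = \sum_(m <= i < m + n) g (N.of_nat i).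
Proof. by rewrite big_map /index_iota addKn. Qed.

Lemma character_totalE c d : N.le 12%num P -> N.lt d P ->
  int_of_Z (character_total P c d) =
  \sum_(a : 'F_p) \sum_(b : 'F_p)
    char_term (quad_char (norm_num (2%:R * a) (a ^+ 2 - residue d * b ^+ 2)))
     (quad_char (norm_den (residue c) (2%:R * a) (a ^+ 2 - residue d * b ^+ 2)))
     (quad_char (norm_disc (residue c) (2%:R * a) (a ^+ 2 - residue d * b ^+ 2))).
Proof.
move=> P12 dP; rewrite /character_total zsumE big_N_range add0n PE sum_Fp.
apply: eq_bigr => i _; rewrite int_of_Z_add int_of_Z_mul zsumE big_map big_N_range.
rewrite sum_Fp_even; last by move=> b; rewrite sqrrN.
have ri n : residue (N.of_nat n) = n%:R by rewrite /residue Nat2N.id.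
rewrite !trace_norm_termE // ri expr0n /= mulr0 oppr0.
congr (_ + _ * _); rewrite add1n; apply: eq_bigr => l _.
have dP' : N.le d P by exact: N.lt_le_incl.
have mE : residue ((P - d) * N.of_nat l * N.of_nat l mod P)%num =
    - (residue d * l%:R ^+ 2).
  by rewrite residue_mod !residueM residueB // ri -mulrA -expr2 mulNr.
by rewrite (trace_norm_termE _ _ _ P12 erefl) mE ri.
Qed.

End Correctness.

(** Here d is a nonsquare modulo p, used to present k as F_p(sqrt d). *)
Lemma character_check_correct (p : nat) (k : finFieldType)
    (j : {rmorphism 'F_p -> k}) (P c d : N) :
  prime p -> odd p -> N.to_nat P = p -> #|k| = (p ^ 2)%N -> (12 %| #|k|.-1)%N ->
  3%:R != 0 :> k -> character_check P c d ->
  (j (residue p c) ^+ 3 + 27%:R != 0) /\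
  #|curve_point (j (residue p c))| = (p ^ 2 + 1 + 2 * 10 * p)%N.
Proof.
move=> pp p_odd PE hk k12 three0 /and5P [/Z.eqb_eq sq /negP c0 /N.ltb_lt dP /N.leb_le P12].
move=> /Z.eqb_eq tot.
have cc : j (residue p c) ^+ 3 + 27%:R != 0.
  rewrite -rmorphXn -(rmorph_nat j) -rmorphD fmorph_eq0; apply/negP => /eqP E; apply: c0.
  rewrite -(residue_eq0 pp p_odd PE) !residueD !residueM; apply/eqP.
  by rewrite -E -[residue p 27%num]/(27%:R); ring.
split=> //.
have odd_k : odd #|k| by rewrite hk oddX p_odd.
have dns : quad_char (residue p d) = -1 by rewrite -(legendreE pp p_odd PE dP) sq.
have [r rd] := nonsquare_sqrt j pp p_odd hk dns.
apply/eqP; rewrite -eqz_nat card_curve_point // sum_torus_point // sum_trace //.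
rewrite (sum_char_term pp p_odd hk dns rd) -(character_totalE pp p_odd PE) // tot.
apply/eqP; rewrite -PE expnS expn1; move: (N.to_nat P) (N2Nat.id P) => q <-.
by lia.
Qed.

(** * Maximality *)

Section Maximality.
Local Open Scope classical_set_scope.
Local Open Scope card_scope.
Local Open Scope ring_scope.

Lemma plane_curve_coordinates (k : finFieldType) (c : k) (X : plane_curve (U_eqn c)) :
  coordinates (Defs.constant X) c (coord_x X) (coord_y X).
Proof.
by split; [exact: (@equation_ideal _ _ X) | exact: (@coord_generate _ _ X)].
Qed.

Lemma maximal_sextic (p : nat) (k : finFieldType) (c : k) :
  6%:R != 0 :> k -> c ^+ 3 + 27%:R != 0 ->
  #|curve_point c| = (p ^ 2 + 1 + 2 * 10 * p)%N -> maximal_plane_curve p (U_eqn c).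
Proof.
move=> six0 c0 card; split.
  apply: plane_curve_exists.
  - exact: sextic_monic.
  - exact: sextic_fraction_irreducible.
  - exact: sextic_geometrically_irreducible.
move=> X; have xy := plane_curve_coordinates X.
have pts : rational_points (Defs.constant X) #= `I_(p ^ 2 + 1 + 2 * 10 * p).
  by rewrite -card; apply: (rational_points_card six0 c0 xy).
exists 10; last exact: pts.
apply: (sextic_genus six0 c0 xy).
by move: pts; rewrite addnAC addn1 => /eq_cardSP [O [vO _] _]; exists O.
Qed.

(* The last argument of each check is a nonsquare modulo the prime. *)
Lemma check_89 : character_check 89%num 58%num 3%num. Proof. by vm_compute. Qed.
Lemma check_101 : character_check 101%num 96%num 2%num. Proof. by vm_compute. Qed.
Lemma check_131 : character_check 131%num 100%num 2%num. Proof. by vm_compute. Qed.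
Lemma check_191 : character_check 191%num 116%num 7%num. Proof. by vm_compute. Qed.
Lemma check_227 : character_check 227%num 69%num 2%num. Proof. by vm_compute. Qed.
Lemma check_239 : character_check 239%num 94%num 7%num. Proof. by vm_compute. Qed.
Lemma check_251 : character_check 251%num 3%num 11%num. Proof. by vm_compute. Qed.

(** As p is 5 modulo 6, the integer p^2 - 1 is a multiple of 12, so that k
   contains the sixth roots of -1. *)
Lemma maximal_of_check (P B d : N) (p b : nat) (k : finFieldType) (j : {rmorphism 'F_p -> k}) :
  N.to_nat P = p -> N.to_nat B = b -> character_check P B d ->
  prime p -> (p %% 6 == 5)%N -> #|k| = (p ^ 2)%N ->
  maximal_plane_curve p (base_change j (U_eqn (b%:R : 'F_p))).
Proof.
move=> PE BE chk pp p6 hk; rewrite base_change_U_eqn.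
have pk : p \in [pchar k] by apply: (rmorph_pchar j); exact: pchar_Fp.
have p_odd : odd p by move: p6 => /eqP; lia.
have k12 : (12 %| #|k|.-1)%N.
  rewrite hk expnS expn1 (divn_eq p 6) (eqP p6).
  by apply/dvdnP; exists ((p %/ 6) * (3 * (p %/ 6) + 5) + 2)%N; lia.
have p5 : (5 <= p)%N by rewrite -(eqP p6) leq_mod.
have ndiv n : (0 < n)%N -> (n < 5)%N -> n%:R != 0 :> k.
  move=> n0 n5; rewrite -(dvdn_pcharf pk) gtnNdvd //; exact: leq_trans p5.
have three0 : 3%:R != 0 :> k by apply: ndiv.
have six0 : 6%:R != 0 :> k by rewrite (natrM _ 2 3) mulf_neq0 // ndiv.
have [] := character_check_correct j pp p_odd PE hk k12 three0 chk.
rewrite /residue BE; exact: maximal_sextic.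
Qed.

End Maximality.

Local Close Scope ring_scope.

Theorem proposition5p3 (p b : nat)
    (hpb : (p, b) \in [:: (89, 58); (101, 96); (131, 100); (191, 116);
                          (227, 69); (239, 94); (251, 3)])
    (k : finFieldType) (hk : #|k| = p ^ 2)
    (j : {rmorphism 'F_p -> k}) :
  maximal_plane_curve p (base_change j (U_eqn (b%:R : 'F_p)%R)).
Proof.
have main (P B d : N) : N.to_nat P = p -> N.to_nat B = b -> character_check P B d ->
    prime p -> p %% 6 == 5 ->
    maximal_plane_curve p (base_change j (U_eqn (b%:R : 'F_p)%R)).
  by move=> *; apply: (@maximal_of_check P B d).
clear hk; move: hpb; rewrite !inE !xpair_eqE.
do 6?[case/orP]; case/andP => /eqP pE /eqP bE; subst p b.
- exact: (main 89%num 58%num 3%num (erefl 89) (erefl 58) check_89 isT isT).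
- exact: (main 101%num 96%num 2%num (erefl 101) (erefl 96) check_101 isT isT).
- exact: (main 131%num 100%num 2%num (erefl 131) (erefl 100) check_131 isT isT).
- exact: (main 191%num 116%num 7%num (erefl 191) (erefl 116) check_191 isT isT).
- exact: (main 227%num 69%num 2%num (erefl 227) (erefl 69) check_227 isT isT).
- exact: (main 239%num 94%num 7%num (erefl 239) (erefl 94) check_239 isT isT).
- exact: (main 251%num 3%num 11%num (erefl 251) (erefl 3) check_251 isT isT).
Qed.
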